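(* There exists a polynomial-time algorithm that, given an instance $I=(C,V,\Pi,p)$ of maximin-shift-bribery with $|C|=m$, outputs a shift-action $\mathbf{s}$ such that $p$ is a (maximin) winner in $\mathrm{shf}(C,V,\mathbf{s})$ and $\Pi(\mathbf{s})=O(\log m)\cdot\mathrm{opt}(I)$.
   Context: $\mathbb{Z}^+$ denotes the set of all nonnegative integers. An election is a pair $E=(C,V)$ with $C$ a set of $m$ candidates and $V=(v^1,\dots,v^n)$ a list of voters, each voter $v^i$ being a strict linear order $\succ^i$ over $C$. Maximin: let $N_E(a,b)$ be the number of voters in $E$ who prefer $a$ to $b$. The maximin score of a candidate $a$ is $\min_{b\in C\setminus\{a\}}N_E(a,b)$. The winners are all candidates with the maximum score (ties allowed). $\mathcal{R}$-shift-bribery: an instance is $I=(C,V,\Pi,p)$ where $C=\{p,c_1,\dots,c_{m-1}\}$, $V=(v^1,\dots,v^n)$ is a list of linear orders over $C$, $p\in C$ is the designated candidate, and $\Pi=(\pi^1,\dots,\pi^n)$ is a list of cost functions $\pi^i:\mathbb{Z}^+\to\mathbb{Z}^+$ with $\pi^i(0)=0$, $\pi^i(k)\le\pi^i(k+1)$ for all $k$, and $\pi^i(s)=\pi^i(t-1)$ for all $s\ge t$, where $t$ is the position of $p$ in $\succ^i$. A shift-action is $\mathbf{t}=(t_1,\dots,t_n)\in(\mathbb{Z}^+)^n$; its cost is $\Pi(\mathbf{t})=\sum_{i=1}^n\pi^i(t_i)$. The election $\mathrm{shf}(C,V,\mathbf{t})$ is obtained from $(C,V)$ by moving $p$ upwards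 by $t_i$ positions in the $i$-th vote for each $i$ (or to the top if fewer than $t_i$ candidates are above $p$), leaving the relative order of the other candidates unchanged. $\mathbf{t}$ is successful if $p$ is an $\mathcal{R}$-winner of $\mathrm{shf}(C,V,\mathbf{t})$, and $\mathrm{opt}(I)$ is the minimum of $\Pi(\mathbf{t})$ over successful shift-actions. Running time is measured in the representation size of $I$, with all entries of $\Pi$ written in binary. The bound $\Pi(\mathbf{s})=O(\log m)\cdot\mathrm{opt}(I)$ means that there is an absolute constant $\kappa$ with $\Pi(\mathbf{s})\le \kappa\log m\cdot\mathrm{opt}(I)$ for all instances with $m\ge 2$. *)

(* Defs.v *)
From mathcomp Require Import all_boot all_order all_algebra.
From mathcomp Require Import boolp reals exp.

Set Implicit Arguments.
Unset Strict Implicit.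
Unset Printing Implicit Defensive.

(** * Elections and the maximin rule *)

Section Maximin.
Variable C : finType.
Implicit Types (v : seq C) (V : seq (seq C)) (a b p : C).

(* A strict linear order over [C] is the duplicate-free list of all the
   candidates, most preferred first. *)
Definition linear_order v : bool := perm_eq v (enum C).

Definition prefers v a b : bool := (index a v < index b v)%N.

Definition support V a b : nat := count (fun v => prefers v a b) V.

(* No support exceeds [size V], so this neutral element only matters for the
   empty minimum, that is, when [C] has a single candidate. *)
Definition maximin_score V a : nat :=
  \big[minn/size V]_(b : C | b != a) support V a b.

Definition maximin_winner V a : bool :=
  [forall b, (maximin_score V b <= maximin_score V a)%N].

(* [index p v] candidates are above [p] in [v]; the truncated subtraction sends
   [p] to the top when fewer than [k] candidates are above it. *)
Definition shift p (k : nat) v : seq C :=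
  let others := rem p v in
  let above := (index p v - k)%N in
  take above others ++ p :: drop above others.

Definition shf p n (V : n.-tuple (seq C)) (t : n.-tuple nat) :
    n.-tuple (seq C) :=
  [tuple shift p (tnth t i) (tnth V i) | i < n].

End Maximin.

(** * Maximin-shift-bribery *)

(* The position [t] of [target] in a vote is counted from 1, hence
   [t - 1 = index target vote]. *)
Record instance := Instance {
  ncand : nat;
  nvoter : nat;
  votes : nvoter.-tuple (seq 'I_ncand);
  target : 'I_ncand;
  price : 'I_nvoter -> nat -> nat;
  votesP : forall i, linear_order (tnth votes i);
  price0 : forall i, price i 0 = 0;
  price_mono : forall i k, price i k <= price i k.+1;
  price_stable : forall i s, (index target (tnth votes i)).+1 <= s ->
    price i s = price i (index target (tnth votes i))
}.

Definition shift_cost (I : instance) (t : (nvoter I).-tuple nat) : nat :=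
  \sum_(i < nvoter I) price i (tnth t i).

Definition successful (I : instance) (t : (nvoter I).-tuple nat) : bool :=
  maximin_winner (shf (target I) (votes I) t) (target I).

Definition success_cost (I : instance) (k : nat) : bool :=
  `[< exists t, successful t /\ @shift_cost I t = k >].

(* Moving [target] to the top of every vote is always successful. *)
Lemma success_cost_ex (I : instance) : exists k, success_cost I k.
Proof.
pose t := [tuple ncand I | i < nvoter I].
exists (shift_cost t); apply/asboolP; exists t; split=> //.
set p := target I; rewrite /successful -/p.
set W := shf _ _ _.
have score_le b : maximin_score W b <= size W.
  rewrite /maximin_score; elim/big_rec: _ => // c x _ le_x.
  exact: leq_trans (geq_minr _ _) le_x.
apply/forallP => b; apply: leq_trans (score_le b) _.
rewrite /maximin_score; elim/big_rec: _ => // c x neq_cp le_x.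
rewrite leq_min le_x andbT.
suff: all (fun v => prefers v p c) W by rewrite all_count /support => /eqP ->.
apply/all_tnthP => i; rewrite tnth_mktuple tnth_mktuple /shift.
have -> : index p (tnth (votes I) i) - ncand I = 0.
  apply/eqP; rewrite subn_eq0 (leq_trans (index_size _ _)) //.
  by rewrite (perm_size (votesP i)) size_enum_ord.
by rewrite take0 drop0 /prefers /= eqxx eq_sym (negPf neq_cp).
Qed.

Definition opt (I : instance) : nat := ex_minn (success_cost_ex I).

(** * Representation of instances *)

(* The length of [x] in binary; it is 1 for [x = 0]. *)
Definition bitlen (x : nat) : nat := (trunc_log 2 x).+1.

(* The numbers of candidates and voters, the designated candidate and, for each
   voter, the ranking followed by the prices of shifts by [0, ..., ncand I - 1];
   by [price_stable] these determine all the prices. *)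
Definition encode (I : instance) : seq nat :=
  [:: ncand I; nvoter I; val (target I)] ++
  flatten [seq [seq val a | a <- tnth (votes I) i] ++
               [seq price i k | k <- iota 0 (ncand I)]
          | i <- enum 'I_(nvoter I)].

Definition rep_size (I : instance) : nat := \sum_(x <- encode I) bitlen x.

(** * Algorithms *)

(* Algorithms are structured programs for the random access machine with
   logarithmic cost of Cook-Reckhow and Aho-Hopcroft-Ullman, which is
   polynomially equivalent to Turing machines: unboundedly many cells holding
   natural numbers, indirect addressing, a read-only input sequence and a
   write-only output sequence. Every number handled by the machine (literal,
   address, cell content, intermediate result) is charged its length in
   binary, so that no value can be longer than the time spent on it. *)

Inductive binop := Plus | Minus | Times | Quotient.

Definition eval_op (o : binop) : nat -> nat -> nat :=
  match o with
  | Plus => addn | Minus => subn | Times => muln | Quotient => divn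
  end.

Inductive expr :=
| Lit of nat
| Cell of expr
| Op of binop & expr & expr.

Inductive prog :=
| Skip
| Store of expr & expr   (* [Store a e]: the cell of address [a] receives [e] *)
| Read of expr           (* the next input goes to the given address *)
| Write of expr
| Then of prog & prog
| If of expr & prog & prog
| While of expr & prog.

Definition memory := nat -> nat.

Definition update (mu : memory) (a x : nat) : memory :=
  fun b => if b == a then x else mu b.

Fixpoint eval (mu : memory) (e : expr) : nat :=
  match e with
  | Lit x => x
  | Cell a => mu (eval mu a)
  | Op o e1 e2 => eval_op o (eval mu e1) (eval mu e2)
  end.

Fixpoint eval_time (mu : memory) (e : expr) : nat :=
  bitlen (eval mu e) +
  match e with
  | Lit _ => 0
  | Cell a => eval_time mu a
  | Op _ e1 e2 => eval_time mu e1 + eval_time mu e2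
  end.

Record state := State {
  mem : memory;
  input : seq nat;
  output : seq nat
}.

(* [exec P st st' T]: from [st], the program [P] halts in [st'] after time [T].
   Nonzero values are true; reading past the end of the input is an error. *)
Inductive exec : prog -> state -> state -> nat -> Prop :=
| exec_Skip st : exec Skip st st 1
| exec_Store a e mu xs ys :
    exec (Store a e) (State mu xs ys)
      (State (update mu (eval mu a) (eval mu e)) xs ys)
      (eval_time mu a + eval_time mu e)
| exec_Read a mu x xs ys :
    exec (Read a) (State mu (x :: xs) ys)
      (State (update mu (eval mu a) x) xs ys)
      (eval_time mu a + bitlen x)
| exec_Write e mu xs ys :
    exec (Write e) (State mu xs ys) (State mu xs (rcons ys (eval mu e)))
      (eval_time mu e)
| exec_Then P Q st1 st2 st3 T1 T2 :
    exec P st1 st2 T1 -> exec Q st2 st3 T2 ->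
    exec (Then P Q) st1 st3 (T1 + T2)
| exec_If e P Q st st' T :
    exec (if eval (mem st) e != 0 then P else Q) st st' T ->
    exec (If e P Q) st st' (eval_time (mem st) e + T)
| exec_While_stop e P st :
    eval (mem st) e = 0 ->
    exec (While e P) st st (eval_time (mem st) e)
| exec_While_loop e P st1 st2 st3 T1 T2 :
    eval (mem st1) e != 0 ->
    exec P st1 st2 T1 -> exec (While e P) st2 st3 T2 ->
    exec (While e P) st1 st3 (eval_time (mem st1) e + T1 + T2).

(* On input [xs], [P] halts after time [T] and has output exactly [ys]. *)
Definition outputs_in (P : prog) (xs ys : seq nat) (T : nat) : Prop :=
  exists mu xs', exec P (State (fun=> 0) xs [::]) (State mu xs' ys) T.

(* Main.v *)
(** Fix the score [B] that [p] is to reach. Moving [p] up only affects comparisons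
    with [p], so [p] wins with score [B] as soon as it is preferred to every other
    candidate [c] by [B] voters and, unless some third candidate already holds the
    score of [c] at most [B], by [n - B] voters. This is a set multicover problem in
    which the item [(i, k)], shifting [p] by [k] in vote [i], has price [pi^i(k)].
    Greedy repeatedly buys an item of least ratio of price to gain. Let [D] be the
    deficit, [th] the last ratio, and [c_i] and [g_i] the price and the current gain
    of the item of an optimal solution in vote [i]; then
    [spent + th D + sum_i (c_i H(g_i) - th g_i)]
    never increases, starts below [H(m) sum_i c_i] and ends above the amount spent.
    The answer is the cheapest result over all [B < n].

    The algorithm is written in a small language of [for] loops over candidates and
    voters that stores no products: a run takes polynomially many steps, each of
    which lengthens the numbers in memory by a constant number of bits. *)

Require Import Defs.
From mathcomp Require Import all_boot all_order all_algebra.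
From mathcomp Require Import boolp reals exp.
From mathcomp Require Import zify ring lra.

Set Implicit Arguments.
Unset Strict Implicit.
Unset Printing Implicit Defensive.

Import Order.TTheory GRing.Theory Num.Theory.

(** * Greedy multicover *)

(** Winning constrains all scores at once, and they change with the shifts. Once [B] is fixed, the
    demands depend only on the original votes, since comparisons among the other candidates never
    move; this is what turns the problem into covering. A wrong guess is harmless: every solution of
    the covering problem for some [B <= n] is successful, so the cheapest result competes in
    particular with the guess read off an optimal solution. Unlike in plain multicover, the items of
    one vote are nested and a solution keeps one per vote. A longer shift replaces the shorter one
    while its full price is charged, so the amount spent only overestimates the cost. Nesting also
    gives diminishing returns: a purchase never increases the gain of another item. An item serves
    each candidate at most once, so no gain exceeds [m]; this is the origin of H(m). On the machine
    the danger is repeated squaring, which makes numbers exponentially long in polynomially many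
    steps. Products are therefore confined to tests and addresses, whose values are not written to
    memory. *)

Section Greedy.
Variables (n m p : nat) (pos pr : nat -> nat -> nat).
Implicit Types (t ts d : nat -> nat).

(* [pos i c] candidates are above [c] in vote [i], where shifting [p] by [k] costs
   [pr i k]. For uniformity, [p] counts as covering itself. *)
Definition covers i k c : bool := pos i p <= pos i c + k.
Definition coverage t c : nat := \sum_(i < n) covers i (t i) c.
Definition gain d t i k : nat :=
  \sum_(c < m) [&& coverage t c < d c, ~~ covers i (t i) c & covers i k c].
Definition deficit d t : nat := \sum_(c < m) (d c - coverage t c).
Definition meets d t : Prop := forall c, c < m -> d c <= coverage t c.
Definition change t i k : nat -> nat := fun j => if j == i then k else t j.
Definition cost t : nat := \sum_(i < n) pr i (t i).

Lemma covers_mono i k k' c : k <= k' -> covers i k c -> covers i k' c.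
Proof. by rewrite /covers => *; lia. Qed.

Lemma gain_gt0 d t i k : 0 < gain d t i k -> t i < k.
Proof.
apply: contraTltn => le_kt; rewrite /gain big1 // => c _.
case: (boolP (covers i k c)) => [cov_k | _]; last by rewrite !andbF.
by rewrite (covers_mono le_kt cov_k) /= andbF.
Qed.

Lemma gain_le d t i k : gain d t i k <= m.
Proof.
rewrite -[leqRHS]card_ord -sum1_card; apply: leq_sum => c _.
by case: [&& _, _ & _].
Qed.

Lemma deficit_le d t : (forall c, d c <= n) -> deficit d t <= n * m.
Proof.
move=> d_le; rewrite mulnC -[X in X * _]card_ord -sum_nat_const.
by apply: leq_sum => c _; rewrite leq_subLR (leq_trans (d_le c)) ?leq_addl.
Qed.

Lemma deficit0 d t : deficit d t = 0 -> meets d t.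
Proof.
move/eqP; rewrite sum_nat_eq0 => /forallP d0 c lt_cm.
by have := d0 (Ordinal lt_cm); rewrite subn_eq0.
Qed.

(** Free of subtraction, so that it serves coverages as well as prices. *)
Lemma sum_change (F : nat -> nat -> nat) t i k : i < n ->
  \sum_(j < n) F j (change t i k j) + F i (t i) = \sum_(j < n) F j (t j) + F i k.
Proof.
move=> lt_in; rewrite (bigD1 (Ordinal lt_in)) //= [in RHS](bigD1 (Ordinal lt_in)) //=.
rewrite {1}/change eqxx.
under eq_bigr => j ne_ji do rewrite /change (negPf (ne_ji : val j != i)).
lia.
Qed.

Lemma coverage_change t i k c : i < n -> t i <= k ->
  coverage (change t i k) c = coverage t c + (~~ covers i (t i) c && covers i k c).
Proof.
move=> lt_in le_tk; have := sum_change (fun j l => covers j l c) t k lt_in.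
rewrite -/(coverage (change t i k) c) -/(coverage t c).
have := @covers_mono i _ _ c le_tk.
case: (covers i (t i) c); case: (covers i k c) => //=; rewrite ?(addn0, addn1) => H; lia.
Qed.

Lemma deficit_change d t i k : i < n -> t i <= k ->
  deficit d (change t i k) + gain d t i k = deficit d t.
Proof.
move=> lt_in le_tk; rewrite /deficit /gain -big_split /=; apply: eq_bigr => c _.
rewrite coverage_change //; case: ltnP => /=; case: (_ && _) => /=; lia.
Qed.

(** Diminishing returns: a longer shift only raises coverages, which can close demands but never
    reopen them. In vote [i] itself the candidates already covered only grow in number. *)
Lemma gain_change_le d t i k j l : i < n -> t i <= k ->
  gain d (change t i k) j l <= gain d t j l.
Proof.
move=> lt_in le_tk; apply: leq_sum => c _.
rewrite coverage_change // /change.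
have sub : coverage t c + (~~ covers i (t i) c && covers i k c) < d c ->
  coverage t c < d c by lia.
have [/sub -> /= | _] := boolP (coverage t c + _ < d c); last by [].
have [->|//] := eqVneq j i.
have := @covers_mono i _ _ c le_tk.
by case: (covers i (t i) c); case: (covers i k c); case: (covers i l c) => // /(_ isT).
Qed.

(* Every feasible solution covers the current deficit, so its items jointly
   gain at least the deficit. *)
Lemma deficit_le_gain d t ts : meets d ts ->
  deficit d t <= \sum_(i < n) gain d t i (ts i).
Proof.
move=> ok; rewrite /gain exchange_big /=; apply: leq_sum => c _.
case: ltnP => [lt_cd|]; last by lia.
rewrite leq_subLR; apply: leq_trans (ok c (ltn_ord c)) _.
rewrite -big_split /=; apply: leq_sum => i _.
by case: (covers i (t i) c); case: (covers i (ts i) c).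
Qed.

(** * The harmonic approximation bound *)

Section Approximation.
Variables (R : realFieldType) (d ts : nat -> nat).
Hypotheses (ts_meets : meets d ts) (ts_lt : forall i, i < n -> ts i < m).
Hypothesis pr0 : forall i, pr i 0 = 0.

Local Open Scope ring_scope.

Definition harmonic g : R := \sum_(j < g) j.+1%:R^-1.

Lemma harmonic_mono g g' : (g <= g')%N -> harmonic g <= harmonic g'.
Proof.
elim: g' => [|g' IH]; first by rewrite leqn0 => /eqP ->.
rewrite leq_eqVlt => /predU1P[-> //|le_gg']; rewrite /harmonic big_ord_recr /=.
by rewrite ler_wpDr ?invr_ge0 ?ler0n ?IH.
Qed.

(** The two sides differ by the terms [x / j - th] with [g' < j <= g]. For [th >= 0] each is
    nonnegative because [th * j <= th * g <= x]; for [th < 0] it is so because [x >= 0]. *)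
Lemma harmonic_gap g g' (x th : R) : 0 <= x -> (g' <= g)%N -> th * g%:R <= x ->
  x * harmonic g' - th * g'%:R <= x * harmonic g - th * g%:R.
Proof.
move=> x0; elim: g => [|g IH]; first by rewrite leqn0 => /eqP ->.
rewrite leq_eqVlt => /predU1P[-> //|le_gg'] le_x.
have [th0|th_neg] := leP 0 th.
  apply: (le_trans (IH le_gg' _)).
    by apply: le_trans le_x; rewrite ler_wpM2l // ler_nat.
  rewrite [harmonic g.+1]big_ord_recr /= -/(harmonic g).
  have le_th : th <= x / g.+1%:R by rewrite ler_pdivlMr ?ltr0Sn.
  have -> : th * g.+1%:R = th * g%:R + th by rewrite -natr1 mulrDr mulr1.
  by rewrite mulrDr opprD addrACA lerDl subr_ge0.
have Hle := harmonic_mono (ltnW le_gg').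
have : (g'%:R : R) <= g.+1%:R by rewrite ler_nat; apply: leqW.
have := ler_wpM2l x0 Hle.
nra.
Qed.

Definition potential t (th : R) : R :=
  th * (deficit d t)%:R +
  \sum_(i < n) ((pr i (ts i))%:R * harmonic (gain d t i (ts i))
                - th * (gain d t i (ts i))%:R).

Definition ratio_ge t (th : R) : Prop :=
  forall i k, (i < n)%N -> (k < m)%N -> th * (gain d t i k)%:R <= (pr i k)%:R.

Definition greedy_inv t : Prop :=
  exists2 th : R, 0 <= th /\ ratio_ge t th
    & (cost t)%:R + potential t th <= harmonic m * (cost ts)%:R.

Lemma greedy_inv0 : greedy_inv (fun=> 0%N).
Proof.
exists 0; first by split=> // i k _ _; rewrite mul0r ler0n.
rewrite /cost big1 ?add0r //.
rewrite /potential mul0r add0r natr_sum mulr_sumr; apply: ler_sum => i _.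
by rewrite mul0r subr0 mulrC ler_wpM2r ?ler0n ?harmonic_mono ?gain_le.
Qed.

(** Raising [th] to the new ratio [th'] changes the potential by [th' - th] times the deficit minus
    the joint gain of the items of [ts], which is at most 0 by [deficit_le_gain]. The purchase then
    lowers the deficit by [g], and [th' * g] is exactly its price. The shrinking gains of [ts] are
    absorbed by [harmonic_gap]. *)
Lemma greedy_inv_change t i k : greedy_inv t -> (i < n)%N -> (k < m)%N ->
  (0 < gain d t i k)%N ->
  (forall j l, (j < n)%N -> (l < m)%N ->
     (pr i k * gain d t j l <= pr j l * gain d t i k)%N) ->
  greedy_inv (change t i k).
Proof.
move=> [th [th0 th_le] le_cost] lt_in lt_km g0 best.
have le_tk := ltnW (gain_gt0 g0).
set g := gain d t i k in g0 best.
have g0R : 0 < g%:R :> R by rewrite ltr0n.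
pose th' : R := (pr i k)%:R / g%:R.
have ratio' : ratio_ge t th'.
  move=> j l lt_jn lt_lm; rewrite /th' mulrAC ler_pdivrMr // -!natrM ler_nat.
  exact: best.
have th'g : th' * g%:R = (pr i k)%:R by rewrite /th' divfK ?gt_eqF.
have le_thth' : th <= th' by rewrite /th' ler_pdivlMr // th_le.
exists th'.
  split; first exact: le_trans le_thth'.
  move=> j l lt_jn lt_lm; apply: le_trans (ratio' j l lt_jn lt_lm).
  by rewrite ler_wpM2l ?ler_nat ?gain_change_le // (le_trans th0).
apply: le_trans le_cost.
(* Only an inequality: the price of the shift replaced in vote [i] is refunded in [cost], but the
   potential pays the new price in full. *)
have le_c : (cost (change t i k))%:R <= (cost t)%:R + (pr i k)%:R :> R.
  by rewrite -natrD ler_nat -(sum_change pr t k lt_in) leq_addr.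
have def : (deficit d (change t i k))%:R + g%:R = (deficit d t)%:R :> R.
  by rewrite -natrD deficit_change.
have sum_le : \sum_(j < n) ((pr j (ts j))%:R * harmonic (gain d (change t i k) j (ts j))
                - th' * (gain d (change t i k) j (ts j))%:R) <=
   \sum_(j < n) ((pr j (ts j))%:R * harmonic (gain d t j (ts j))
                - th' * (gain d t j (ts j))%:R).
  apply: ler_sum => j _; apply: harmonic_gap; rewrite ?ler0n ?gain_change_le //.
  by rewrite ratio' ?ts_lt.
have le_def : (deficit d t)%:R <= \sum_(j < n) (gain d t j (ts j))%:R :> R.
  by rewrite -natr_sum ler_nat deficit_le_gain.
rewrite /potential; move: sum_le.
rewrite !sumrB -!mulr_sumr; nra.
Qed.

Lemma greedy_inv_le t : greedy_inv t ->
  (cost t)%:R <= harmonic m * (cost ts)%:R.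
Proof.
case=> th [th0 th_le]; apply: le_trans; rewrite lerDl.
rewrite addr_ge0 ?mulr_ge0 ?ler0n // sumr_ge0 // => i _.
(* At gain 0 the left-hand side of [harmonic_gap] vanishes, so every summand of the potential is
   nonnegative. *)
have := @harmonic_gap (gain d t i (ts i)) 0 (pr i (ts i))%:R th (ler0n _ _) (leq0n _)
  (th_le i (ts i) (ltn_ord i) (ts_lt (ltn_ord i))).
by rewrite /harmonic big_ord0 !mulr0 subr0.
Qed.

End Approximation.
End Greedy.

(** By induction: [ln (1 + x) <= x] at [x = - 1 / (m + 1)] says that the next term [1 / (m + 1)] is
    at most [ln (m + 1) - ln m]. *)
Lemma harmonic_le_ln (R : realType) m : (0 < m)%N -> (harmonic R m <= 1 + ln m%:R)%R.
Proof.
elim: m => // -[|m] IH _; first by rewrite /harmonic big_ord_recr big_ord0 /= ln1 invr1 add0r addr0.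
rewrite /harmonic big_ord_recr /= -/(harmonic R m.+1).
apply: le_trans (lerD (IH isT) (lexx _)) _; rewrite -addrA lerD2l -lerBrDl.
have m0 : (0 < m.+1%:R :> R)%R by rewrite ltr0n.
have m1 : (0 < m.+2%:R :> R)%R by rewrite ltr0n.
have e : (1 - m.+2%:R^-1 = m.+1%:R / m.+2%:R :> R)%R.
  have m1n0 : (m.+2%:R != 0 :> R)%R by rewrite gt_eqF.
  by rewrite -{1}(divff m1n0) -{2}[(m.+2%:R^-1)%R]mul1r -mulrBl -[in (m.+2%:R - 1)%R]natr1 addrK.
have lt_V : (m.+2%:R^-1 < 1 :> R)%R by rewrite invf_lt1 ?ltr1n.
have := @le_ln1Dx R (- m.+2%:R^-1)%R; rewrite ltrN2 lt_V e => /(_ isT).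
rewrite lnM ?posrE ?invr_gt0 // lnV ?posrE //.
by rewrite lerNr opprB.
Qed.

(** * Winning as a covering problem *)

Section Shift.
Variable C : finType.
Implicit Types (v : seq C) (p a b : C).

Lemma prefers_cons x v a b : prefers (x :: v) a b =
  if x == a then x != b else (x != b) && prefers v a b.
Proof. by rewrite /prefers /=; case: (x == a); case: (x == b). Qed.

Lemma prefers_rem p v a b : a != p -> b != p ->
  prefers (rem p v) a b = prefers v a b.
Proof.
move=> ap bp; elim: v => //= x v IH; rewrite prefers_cons.
case: eqVneq => [->|_]; first by rewrite eq_sym (negPf ap) eq_sym bp.
by rewrite prefers_cons IH.
Qed.

Lemma prefers_insert p k v a b : a != p -> b != p ->
  prefers (take k v ++ p :: drop k v) a b = prefers v a b.
Proof.
move=> ap bp; have ins w : prefers (p :: w) a b = prefers w a b.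
  by rewrite prefers_cons ![p == _]eq_sym (negPf ap) bp.
elim: v k => [|x v IH] [|k] //=; rewrite ?ins //.
by rewrite !prefers_cons IH.
Qed.

Lemma prefers_shift p k v a b : a != p -> b != p ->
  prefers (shift p k v) a b = prefers v a b.
Proof. by move=> ap bp; rewrite prefers_insert // prefers_rem. Qed.

Lemma index_insert p k v : k <= size v -> p \notin v -> 
  (index p (take k v ++ p :: drop k v) = k).
Proof.
move=> le_k pv; rewrite index_cat ifN /= ?eqxx ?addn0 ?size_takel //.
by apply: contra pv; apply: mem_take.
Qed.

(** The target lands at index [K = index p v - k], and exactly the candidates of index below [K] in
    [v] stay above it. Even with truncated subtraction, [K <= index c v] is the same as
    [index p v <= index c v + k]. *)
Lemma prefers_shift_target p k v c : uniq v -> p \in v -> c != p ->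
  prefers (shift p k v) p c = (index p v <= index c v + k).
Proof.
move=> uv pv cp.
have p_rem : p \notin rem p v by rewrite mem_rem_uniq // inE eqxx.
have le_k : index p v - k <= size (rem p v).
  by rewrite size_rem //; have := index_mem p v; rewrite pv; lia.
rewrite /prefers /shift index_insert // index_cat /= eq_sym (negPf cp).
rewrite remE.
have e : index p v - k <= index p v by lia.
move eK : (index p v - k) le_k e => K le_k e.
have tk : take K (take (index p v) v ++ drop (index p v).+1 v) = take K v.
  by rewrite takel_cat ?take_takel // size_takel ?index_size.
rewrite tk; have Kv : K <= size v by rewrite (leq_trans e) ?index_size.
case: ifP => [c_in | /negbT c_nin].
  have lt_K : index c (take K v) < K.
    by rewrite (leq_trans (_ : _ < size (take K v))) ?index_mem ?size_takel.
  have -> : index c v = index c (take K v).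
    by rewrite -{1}(cat_take_drop K v) index_cat c_in.
  lia.
have -> : index c v = K + index c (drop K v).
  by rewrite -{1}(cat_take_drop K v) index_cat (negPf c_nin) size_takel.
rewrite size_takel //; lia.
Qed.

Lemma prefersN v a b : uniq v -> a \in v -> b \in v -> a != b ->
  prefers v b a = ~~ prefers v a b.
Proof.
move=> uv av bv ab; rewrite /prefers -leqNgt ltn_neqAle.
case: eqVneq => // e; case/eqP: ab.
by rewrite -(nth_index a av) -e nth_index.
Qed.

Lemma shift_perm p k v : p \in v -> perm_eq (shift p k v) v.
Proof.
move=> pv; rewrite /shift perm_sym (perm_trans (perm_to_rem pv)) //.
by rewrite perm_sym -cat_rcons -cats1 -catA perm_catCA /= perm_cons cat_take_drop.
Qed.

End Shift.

Section Winner.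
Variables (C : finType) (p : C) (n : nat) (V : n.-tuple (seq C)) (t : n.-tuple nat).
Hypothesis VP : forall i, linear_order (tnth V i).

Let W := shf p V t.

Lemma count_tuple (T : Type) (U : n.-tuple T) (P : pred T) :
  count P U = \sum_(i < n) P (tnth U i).
Proof. by rewrite -sum1_count big_mkcond big_tuple. Qed.

Lemma support_other a b : a != p -> b != p -> Defs.support W a b = Defs.support V a b.
Proof.
move=> ap bp; rewrite /Defs.support !count_tuple; apply: eq_bigr => i _.
by rewrite tnth_mktuple prefers_shift.
Qed.

Lemma vote_uniq i : uniq (tnth V i).
Proof. by rewrite (perm_uniq (VP i)) enum_uniq. Qed.

Lemma vote_mem i c : c \in tnth V i.
Proof. by rewrite (perm_mem (VP i)) mem_enum. Qed.

Lemma support_target c : c != p -> Defs.support W p c =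
  \sum_(i < n) (index p (tnth V i) <= index c (tnth V i) + tnth t i).
Proof.
move=> cp; rewrite /Defs.support count_tuple; apply: eq_bigr => i _.
by rewrite tnth_mktuple prefers_shift_target ?vote_uniq ?vote_mem.
Qed.

Lemma support_target_sym c : c != p -> Defs.support W c p + Defs.support W p c = n.
Proof.
move=> cp; rewrite /Defs.support !count_tuple -big_split /=.
rewrite -[RHS]card_ord -[RHS]sum1_card; apply: eq_bigr => i _; rewrite tnth_mktuple.
have sh := shift_perm (tnth t i) (vote_mem i p).
rewrite (prefersN (a := p)) ?(perm_uniq sh) ?vote_uniq ?(perm_mem sh) ?vote_mem 1?eq_sym //.
by case: prefers.
Qed.

Lemma score_le_support a b : b != a -> maximin_score W a <= Defs.support W a b.
Proof.
move=> ba; rewrite /maximin_score; have := mem_index_enum b.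
elim: index_enum => //= x r IH; rewrite inE big_cons => /predU1P[<- | /IH le_b].
  by rewrite ba geq_minl.
by case: ifP => // _; apply: leq_trans (geq_minr _ _) le_b.
Qed.

(** The conjunct [x <= n] comes from the neutral element of the minimum; it follows from the other
    one unless [a] is the only candidate. *)
Lemma score_geP a x :
  (x <= maximin_score W a) =
  (x <= n) && [forall (b | b != a), x <= Defs.support W a b].
Proof.
apply/idP/andP => [le_x | [le_xn /forallP all_x]].
  split; last first.
    by apply/forallP => b; apply/implyP => /score_le_support; apply: leq_trans.
  apply: leq_trans le_x _; rewrite /maximin_score size_tuple.
  by elim/big_rec: _ => // c y _ le_y; exact: leq_trans (geq_minr _ _) le_y.
rewrite /maximin_score size_tuple; elim/big_rec: _ => // b y ba le_y.
by rewrite leq_min le_y (implyP (all_x b)).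
Qed.

(* The score that [target] must reach for [p] to win with score [B]. A candidate
   [c] whose score is kept at most [B] by a third candidate only has to be
   beaten by [p] in [B] votes; any other one must moreover be kept at most [B]
   by [p] itself. *)
Definition demand B c : nat :=
  if [exists b, [&& b != p, b != c & Defs.support V c b <= B]] then B
  else maxn B (n - B).

Lemma demand_winner B : B <= n ->
  (forall c, c != p -> demand B c <= Defs.support W p c) -> maximin_winner W p.
Proof.
move=> le_Bn ok.
have geB : B <= maximin_score W p.
  rewrite score_geP le_Bn; apply/forallP => c; apply/implyP => cp.
  apply: leq_trans (ok c cp); rewrite /demand; case: ifP => _ //.
  exact: leq_maxl.
apply/forallP => c; have [-> //|cp] := eqVneq c p.
apply: leq_trans geB; move: (ok c cp); rewrite /demand; case: ifP.
  case/existsP => b /and3P[bp bc le_B] _.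
  by apply: leq_trans (score_le_support bc) _; rewrite support_other.
move=> _ le_s; apply: leq_trans (score_le_support (_ : p != c)) _.
  by rewrite eq_sym.
by have := support_target_sym cp; lia.
Qed.

Lemma winner_demand : 0 < n -> maximin_winner W p ->
  exists2 B, B < n & forall c, c != p -> demand B c <= Defs.support W p c.
Proof.
move=> n0 /forallP win.
have dn B c : B < n -> demand B c <= n.
  by rewrite /demand; case: ifP => _; lia.
pose B := maximin_score W p.
have : B <= maximin_score W p by [].
rewrite score_geP => /andP[le_Bn /forallP geB].
(* With score [n], every voter prefers [p] to each other candidate, and the guess [n.-1] is good
   enough since its demands are at most [n]. In the other case [B < n] ensures that the failure of
   [B.+1 <= maximin_score W c] is witnessed by a candidate [b]. *)
move: le_Bn; rewrite leq_eqVlt => /predU1P[eB | lt_Bn].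
  exists n.-1; first by lia.
  move=> c cp; apply: leq_trans (dn _ _ _) _; first by lia.
  by apply: (leq_trans (n := B)); [lia | exact: (implyP (geB c))].
exists B => // c cp; rewrite /demand; case: ifP => [_ | /negbT].
  exact: (implyP (geB c)).
rewrite negb_exists => /forallP no_b; rewrite geq_max (implyP (geB c)) // andTb.
have : ~~ (B < maximin_score W c) by rewrite -leqNgt win.
rewrite score_geP lt_Bn andTb negb_forall => /existsP[b].
rewrite negb_imply -leqNgt => /andP[bc le_B].
(* A witness other than [p] would be a third candidate holding [c] down already in [V], contrary to
   [no_b]. *)
have bp : b = p.
  apply/eqP/negPn/negP => bp; move: (no_b b).
  by rewrite bp bc -support_other // le_B.
move: le_B; rewrite bp; have := support_target_sym cp; lia.
Qed.

End Winner.

(** * Polynomial-time programs *)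

(* Every variable is a whole array; entry [i] of array [a] lives at
   [(a + i) ^ 2 + a], an injective pairing that the machine can compute. A
   scalar is entry 0 of its array. *)
Definition cell (a i : nat) : nat := (a + i) * (a + i) + a.
Definition arr (mu : memory) (a i : nat) : nat := mu (cell a i).
Definition Addr (a : nat) (e : expr) : expr :=
  Op Plus (Op Times (Op Plus (Lit a) e) (Op Plus (Lit a) e)) (Lit a).
Definition Arr (a : nat) (e : expr) : expr := Cell (Addr a e).
Definition Var (a : nat) : expr := Arr a (Lit 0).

(** As [a <= a + i], the value lies below the next square after [(a + i) ^ 2], so it determines
    [a + i] and then [a]. *)
Lemma cell_inj a i b j : cell a i = cell b j -> a = b /\ i = j.
Proof.
rewrite /cell => e; have eq_sum : a + i = b + j.
  by case: (ltngtP (a + i) (b + j)) => // lt_s; nia.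
by split; [move: e; rewrite eq_sum | ]; nia.
Qed.

Lemma arr_update mu a i x b j :
  arr (update mu (cell a i) x) b j = if (b == a) && (j == i) then x else arr mu b j.
Proof.
rewrite /arr /update; case: eqVneq => [/cell_inj[-> ->]|ne]; first by rewrite !eqxx.
by case: eqP => //= eb; case: eqP => //= ej; rewrite eb ej eqxx in ne.
Qed.

Lemma eval_Addr mu a e : eval mu (Addr a e) = cell a (eval mu e).
Proof. by []. Qed.

Lemma eval_Arr mu a e : eval mu (Arr a e) = arr mu a (eval mu e).
Proof. by []. Qed.

Lemma eval_Var mu a : eval mu (Var a) = arr mu a 0.
Proof. by []. Qed.

Fixpoint esize (e : expr) : nat :=
  match e with
  | Lit x => x.+1
  | Cell a => (esize a).+1
  | Op _ e1 e2 => (esize e1 + esize e2).+1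
  end.

(* Storing only such values lengthens the longest cell by a constant number of
   bits, so that an execution of polynomially many steps takes polynomial time. *)
Fixpoint product_free (e : expr) : bool :=
  match e with
  | Lit _ | Cell _ => true
  | Op Plus e1 e2 | Op Minus e1 e2 => product_free e1 && product_free e2
  | Op Defs.Quotient e1 _ => product_free e1
  | Op Times _ _ => false
  end.

Lemma bitlen_le x k : 0 < k -> x < 2 ^ k -> bitlen x <= k.
Proof.
rewrite /bitlen; case: x => [|x] k0 lt_x; first by rewrite trunc_log0.
by rewrite -(ltn_exp2l (m := 2)) //; apply: leq_ltn_trans (trunc_logP _ _) lt_x.
Qed.

Lemma lt_bitlen x : x < 2 ^ bitlen x.
Proof. exact: trunc_log_ltn. Qed.

Section Bounds.
Variables (mu : memory) (L : nat).
Hypotheses (L0 : 0 < L) (mu_lt : forall a, mu a < 2 ^ L).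

Lemma esize_gt0 e : 0 < esize e. Proof. by case: e. Qed.

Lemma eval_op_lt o x y a b : 0 < a -> 0 < b -> x < 2 ^ a -> y < 2 ^ b ->
  eval_op o x y < 2 ^ (a + b).
Proof.
move=> a0 b0 lt_x lt_y; rewrite expnD.
have a2 : 2 <= 2 ^ a by rewrite -{1}(expn1 2) leq_exp2l.
have b2 : 2 <= 2 ^ b by rewrite -{1}(expn1 2) leq_exp2l.
case: o => /=; [nia | nia | nia | ].
by apply: leq_ltn_trans (leq_div _ _) _; nia.
Qed.

(** Multiplication adds lengths, so an intermediate value may be a fixed multiple of [L] bits long.
    This is good enough for the time of one step, but not for stored values, which have to obey
    [product_free_lt]. *)
Lemma eval_lt e : eval mu e < 2 ^ (esize e * L).
Proof.
elim: e => [x | e _ | o e1 IH1 e2 IH2].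
- apply: leq_trans (ltn_expl x (isT : 1 < 2)) _; rewrite leq_exp2l //=; nia.
- by apply: leq_trans (mu_lt _) _; rewrite leq_exp2l //=; nia.
have lt_op : eval mu (Op o e1 e2) < 2 ^ (esize e1 * L + esize e2 * L).
  by apply: eval_op_lt; rewrite // muln_gt0 esize_gt0.
by apply: leq_trans lt_op _; rewrite leq_exp2l //=; nia.
Qed.

Lemma eval_time_le e : eval_time mu e <= esize e ^ 2 * L.
Proof.
have len_le e' : bitlen (eval mu e') <= esize e' * L.
  by apply: bitlen_le (eval_lt _); rewrite muln_gt0 esize_gt0.
elim: e => [x | e IH | o e1 IH1 e2 IH2].
- have /= := len_le (Lit x); rewrite addn0 => /leq_trans; apply.
  by rewrite leq_mul2r expnS leq_pmulr ?orbT // expn_gt0.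
- apply: leq_trans (leq_add (len_le (Cell e)) IH) _.
  by rewrite -mulnDl leq_mul2r /= !expnS expn0; apply/orP; right; nia.
apply: leq_trans (leq_add (len_le (Op o e1 e2)) (leq_add IH1 IH2)) _.
by rewrite -!mulnDl leq_mul2r /= !expnS expn0; apply/orP; right; nia.
Qed.

Lemma product_free_lt e : product_free e -> eval mu e < 2 ^ (L + esize e).
Proof.
elim: e => [x _ | e _ _ | o e1 IH1 e2 IH2 lin].
- apply: leq_trans (ltn_expl x (isT : 1 < 2)) _; rewrite leq_exp2l //=; lia.
- by apply: leq_trans (mu_lt _) _; rewrite leq_exp2l //=; lia.
have le1 : 2 ^ (L + esize e1) * 2 <= 2 ^ (L + esize (Op o e1 e2)).
  by rewrite -expnSr leq_exp2l //=; lia.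
have le2 : 2 ^ (L + esize e2) * 2 <= 2 ^ (L + esize (Op o e1 e2)).
  by rewrite -expnSr leq_exp2l //=; lia.
case: o lin le1 le2 => //= [/andP[/IH1 ? /IH2 ?] | /andP[/IH1 ? _] | /IH1 ?]; try lia.
by have := leq_div (eval mu e1) (eval mu e2); lia.
Qed.

End Bounds.

Definition bounded (L : nat) (st : state) : Prop :=
  [/\ 0 < L, forall a, Defs.mem st a < 2 ^ L & forall x, x \in input st -> x < 2 ^ L].

Lemma bounded_le L L' st : L <= L' -> bounded L st -> bounded L' st.
Proof.
move=> le_L [L0 mu_lt xs_lt]; have le_2L : 2 ^ L <= 2 ^ L' by rewrite leq_exp2l.
split=> [|a|x /xs_lt]; first exact: leq_trans le_L.
  exact: leq_trans le_2L.
by move/leq_trans; apply.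
Qed.

(** * Total-correctness triples that count steps and bits *)

Section Hoare.
Variable K : nat.

(* [s] counts elementary steps; each adds at most [K] bits to the longest cell
   and takes time at most [K ^ 2] times the length of that cell. *)
Definition time_bound (s L : nat) : nat := s * K ^ 2 * (L + s * K).

(** The length [L] is quantified inside the triple, so that in a sequence the second program can
    start from the length left by the first. *)
Definition hoare (s : nat) (P : state -> Prop) (c : prog) (Q : state -> Prop) :=
  forall L st, P st -> bounded L st ->
  exists st' T, [/\ exec c st st' T, Q st', bounded (L + s * K) st'
                 & T <= time_bound s L].

Lemma time_bound_mono s s' L : s <= s' -> time_bound s L <= time_bound s' L.
Proof. by move=> le_s; rewrite !(leq_mul, leq_add2l). Qed.

Lemma time_bound_add s s' L :
  time_bound s L + time_bound s' (L + s * K) <= time_bound (s + s') L.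
Proof.
rewrite /time_bound -addnA -(mulnDl s s' K).
apply: (@leq_trans (s * K ^ 2 * (L + (s + s') * K) + s' * K ^ 2 * (L + (s + s') * K))).
  by rewrite leq_add2r leq_mul // leq_add2l leq_mul // leq_addr.
by rewrite -mulnDl -mulnDl.
Qed.

Lemma hoare_conseq s s' (P P' Q Q' : state -> Prop) c :
  s <= s' -> (forall st, P' st -> P st) -> (forall st, Q st -> Q' st) ->
  hoare s P c Q -> hoare s' P' c Q'.
Proof.
move=> le_s imP imQ h L st /imP Pst bd; have [st' [T [ex Qst bd' leT]]] := h L st Pst bd.
exists st', T; split=> //; first exact: imQ.
  by apply: bounded_le bd'; rewrite leq_add2l leq_mul.
exact: leq_trans (time_bound_mono _ le_s).
Qed.

Lemma hoare_Then s1 s2 P Q S c1 c2 :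
  hoare s1 P c1 Q -> hoare s2 Q c2 S -> hoare (s1 + s2) P (Then c1 c2) S.
Proof.
move=> h1 h2 L st Pst bd.
have [st1 [T1 [ex1 Q1 bd1 le1]]] := h1 L st Pst bd.
have [st2 [T2 [ex2 S2 bd2 le2]]] := h2 _ _ Q1 bd1.
exists st2, (T1 + T2); split=> //; first exact: exec_Then ex1 ex2.
  by rewrite mulnDl addnA.
by apply: leq_trans (leq_add le1 le2) (time_bound_add _ _ _).
Qed.

Lemma expr_time L st e : bounded L st -> esize e <= K ->
  eval_time (Defs.mem st) e <= K ^ 2 * L.
Proof.
case=> L0 mu_lt _ le_K; apply: leq_trans (eval_time_le L0 mu_lt e) _.
by rewrite leq_mul // leq_exp2r.
Qed.

Lemma hoare_Store a e (P : state -> Prop) : esize a + esize e <= K -> product_free e ->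
  hoare 1 (fun st => P (State (update (Defs.mem st) (eval (Defs.mem st) a) (eval (Defs.mem st) e))
                              (input st) (output st)))
        (Store a e) P.
Proof.
move=> le_K lin L [mu xs ys] Pst bd; have [L0 mu_lt xs_lt] := bd.
exists (State (update mu (eval mu a) (eval mu e)) xs ys).
exists (eval_time mu a + eval_time mu e); split=> //; first exact: exec_Store.
  have [] : bounded (L + 1 * K) (State mu xs ys) by apply: bounded_le bd; lia.
  move=> L0' mu_lt' xs_lt'; split=> // b /=; rewrite /update; case: ifP => // _.
  by apply: leq_trans (product_free_lt L0 mu_lt lin) _; rewrite leq_exp2l //; lia.
rewrite /time_bound mul1n.
have /= := eval_time_le L0 mu_lt a; have /= := eval_time_le L0 mu_lt e.
have : esize a ^ 2 + esize e ^ 2 <= K ^ 2.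
  by apply: leq_trans (_ : (esize a + esize e) ^ 2 <= _); rewrite ?leq_exp2r ?sqrnD ?leq_addr.
nia.
Qed.

Lemma hoare_Read a (P : state -> Prop) : esize a < K ->
  hoare 1 (fun st => input st != [::] /\
             P (State (update (Defs.mem st) (eval (Defs.mem st) a) (head 0 (input st)))
                      (behead (input st)) (output st)))
        (Read a) P.
Proof.
move=> lt_K L [mu [|x xs] ys] [] // _ Pst bd; have [L0 mu_lt xs_lt] := bd.
exists (State (update mu (eval mu a) x) xs ys).
exists (eval_time mu a + bitlen x); split=> //; first exact: exec_Read.
  have [] : bounded (L + 1 * K) (State mu (x :: xs) ys) by apply: bounded_le bd; lia.
  move=> L0' mu_lt' xs_lt'; split=> // [b|y y_xs] /=; last first.
    by apply: xs_lt'; rewrite inE y_xs orbT.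
  by rewrite /update; case: ifP => // _; apply: xs_lt'; rewrite inE eqxx.
have /= := eval_time_le L0 mu_lt a.
have : bitlen x <= L by apply: bitlen_le => //; apply: xs_lt; rewrite inE eqxx.
have : esize a ^ 2 + 1 <= K ^ 2.
  by rewrite addn1 ltn_exp2r.
rewrite /time_bound; nia.
Qed.

Lemma hoare_Write e (P : state -> Prop) : esize e <= K ->
  hoare 1 (fun st => P (State (Defs.mem st) (input st)
                              (rcons (output st) (eval (Defs.mem st) e))))
        (Write e) P.
Proof.
move=> le_K L [mu xs ys] Pst bd.
exists (State mu xs (rcons ys (eval mu e))), (eval_time mu e); split=> //.
- exact: exec_Write.
- have [] : bounded (L + 1 * K) (State mu xs ys) by apply: bounded_le bd; lia.
  by move=> *; split.
by have := expr_time bd le_K; rewrite /time_bound /=; nia.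
Qed.

Lemma hoare_Skip P : 0 < K -> hoare 1 P Skip P.
Proof.
move=> K0 L st Pst bd; exists st, 1; split=> //; first exact: exec_Skip.
  by apply: bounded_le bd; lia.
by have [L0 _ _] := bd; rewrite /time_bound mul1n muln_gt0 expn_gt0 K0 /=; lia.
Qed.

Lemma hoare_If s1 s2 e P Q c1 c2 : esize e <= K ->
  hoare s1 (fun st => P st /\ eval (Defs.mem st) e != 0) c1 Q ->
  hoare s2 (fun st => P st /\ eval (Defs.mem st) e = 0) c2 Q ->
  hoare (1 + s1 + s2) P (If e c1 c2) Q.
Proof.
move=> le_K h1 h2 L st Pst bd.
have test := expr_time bd le_K.
have fin s : (s <= s1 + s2) -> (exists st' T,
    [/\ exec (if eval (Defs.mem st) e != 0 then c1 else c2) st st' T, Q st',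
        bounded (L + s * K) st' & T <= time_bound s L]) ->
   exists st' T, [/\ exec (If e c1 c2) st st' T, Q st',
        bounded (L + (1 + s1 + s2) * K) st' & T <= time_bound (1 + s1 + s2) L].
  move=> le_s [st' [T [ex Qst bd' leT]]]; exists st', (eval_time (Defs.mem st) e + T).
  split=> //; first exact: exec_If.
    by apply: bounded_le bd'; nia.
  have := leq_trans leT (time_bound_mono L le_s).
  have := time_bound_add 1 (s1 + s2) L.
  have : time_bound (s1 + s2) L <= time_bound (s1 + s2) (L + 1 * K).
    by rewrite /time_bound leq_mul // leq_add2r leq_addr.
  by rewrite {3}/time_bound addnA; nia.
have [e0|e0] := eqVneq (eval (Defs.mem st) e) 0.
  apply: (fin s2); first exact: leq_addl.
  by rewrite e0 eqxx; apply: h2.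
apply: (fin s1); first exact: leq_addr.
by rewrite e0; apply: h1.
Qed.

Lemma hoare_While s x b c N (Inv : nat -> state -> Prop) :
  esize (Op Minus (Var b) (Var x)) <= K ->
  (forall j st, Inv j st -> arr (Defs.mem st) x 0 = j /\ arr (Defs.mem st) b 0 = N) ->
  (forall j, j < N -> hoare s (Inv j) c (Inv j.+1)) ->
  hoare (N * s.+1).+1 (Inv 0) (While (Op Minus (Var b) (Var x)) c) (Inv N).
Proof.
move=> le_K loop body.
have ev mu : eval mu (Op Minus (Var b) (Var x)) = arr mu b 0 - arr mu x 0 by [].
suff h k j : j + k = N ->
    hoare (k * s.+1).+1 (Inv j) (While (Op Minus (Var b) (Var x)) c) (Inv N).
  exact: h.
elim: k j => [|k IH] j jk L st Pst bd.
  have [ex eb] := loop j st Pst.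
  have e0 : eval (Defs.mem st) (Op Minus (Var b) (Var x)) = 0.
    by rewrite ev ex eb; lia.
  exists st, (eval_time (Defs.mem st) (Op Minus (Var b) (Var x))); split.
  - exact: exec_While_stop.
  - by rewrite -jk addn0.
  - by apply: bounded_le bd; lia.
  by have := expr_time bd le_K; rewrite /time_bound; nia.
have [ex eb] := loop j st Pst.
have e0 : eval (Defs.mem st) (Op Minus (Var b) (Var x)) != 0.
  by rewrite -lt0n ev ex eb; lia.
have lt_jN : j < N by lia.
have [st1 [T1 [ex1 Q1 bd1 le1]]] := body j lt_jN L st Pst bd.
have jk1 : j.+1 + k = N by lia.
have [st2 [T2 [ex2 Q2 bd2 le2]]] := IH j.+1 jk1 _ _ Q1 bd1.
exists st2, (eval_time (Defs.mem st) (Op Minus (Var b) (Var x)) + T1 + T2); split=> //.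
- exact: exec_While_loop ex1 ex2.
- by apply: bounded_le bd2; nia.
have := expr_time bd le_K.
have := time_bound_add s (k * s.+1).+1 L.
have := time_bound_add 1 (s + (k * s.+1).+1) L.
have : time_bound (s + (k * s.+1).+1) L <= time_bound (s + (k * s.+1).+1) (L + 1 * K).
  by rewrite /time_bound leq_mul // leq_add2r leq_addr.
have -> : 1 + (s + (k * s.+1).+1) = (k.+1 * s.+1).+1 by lia.
rewrite [time_bound 1 L]/time_bound; nia.
Qed.

End Hoare.

(* [CFor x b c] runs [c] for [x = 0, ..., N - 1], where [N] is the value of the
   variable [b]. *)
Inductive cmd :=
| CSkip
| CSet of nat & expr & expr
| CSeq of cmd & cmd
| CIf of expr & cmd & cmd
| CFor of nat & nat & cmd.

Definition loop (x b : nat) (body : prog) : prog :=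
  Then (Store (Addr x (Lit 0)) (Lit 0))
       (While (Op Minus (Var b) (Var x))
              (Then body (Store (Addr x (Lit 0)) (Op Plus (Var x) (Lit 1))))).

Fixpoint compile (c : cmd) : prog :=
  match c with
  | CSkip => Skip
  | CSet a i e => Store (Addr a i) e
  | CSeq c1 c2 => Then (compile c1) (compile c2)
  | CIf e c1 c2 => If e (compile c1) (compile c2)
  | CFor x b c => loop x b (compile c)
  end.

(** Each number of iterations is fixed on entry to the loop, so the semantics is a total function.
    The last update mirrors the final value of the counter in the compiled loop. *)
Fixpoint sem (c : cmd) (mu : memory) : memory :=
  match c with
  | CSkip => mu
  | CSet a i e => update mu (cell a (eval mu i)) (eval mu e)
  | CSeq c1 c2 => sem c2 (sem c1 mu)
  | CIf e c1 c2 => if eval mu e != 0 then sem c1 mu else sem c2 mu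
  | CFor x b c =>
      let N := arr mu b 0 in
      update (iteri N (fun j mu => sem c (update mu (cell x 0) j)) mu) (cell x 0) N
  end.

Fixpoint writes (c : cmd) : seq nat :=
  match c with
  | CSkip => [::]
  | CSet a _ _ => [:: a]
  | CSeq c1 c2 | CIf _ c1 c2 => writes c1 ++ writes c2
  | CFor x _ c => x :: writes c
  end.

(* The numbers of candidates and of voters, which bound all loops. *)
Local Notation vM := 0 (only parsing).
Local Notation vN := 1 (only parsing).

(** Loops are bounded by the two input sizes only, and these are never overwritten; hence [steps] is
    a polynomial in a common bound [S]. Indices in [CSet] may contain products, since only the
    stored value lengthens a cell. *)
Fixpoint wf (c : cmd) : bool :=
  match c with
  | CSkip => true
  | CSet a _ e => (a \notin [:: vM; vN]) && product_free e
  | CSeq c1 c2 | CIf _ c1 c2 => wf c1 && wf c2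
  | CFor x b c =>
      [&& b \in [:: vM; vN], x \notin [:: vM; vN], x \notin writes c & wf c]
  end.

Definition loop_weight (x b : nat) : nat :=
  esize (Addr x (Lit 0)) + esize (Op Minus (Var b) (Var x)) +
  esize (Op Plus (Var x) (Lit 1)).

Fixpoint weight (c : cmd) : nat :=
  match c with
  | CSkip => 0
  | CSet a i e => esize (Addr a i) + esize e
  | CSeq c1 c2 => weight c1 + weight c2
  | CIf e c1 c2 => esize e + weight c1 + weight c2
  | CFor x b c => loop_weight x b + weight c
  end.

Fixpoint steps (S : nat) (c : cmd) : nat :=
  match c with
  | CSkip | CSet _ _ _ => 1
  | CSeq c1 c2 => steps S c1 + steps S c2
  | CIf _ c1 c2 => 1 + steps S c1 + steps S c2
  | CFor _ _ c => 2 + S * (2 + steps S c)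
  end.

Lemma sem_frame c mu a i : a \notin writes c -> arr (sem c mu) a i = arr mu a i.
Proof.
elim: c mu => //= [b j e|c1 IH1 c2 IH2|e c1 IH1 c2 IH2|x b c IH] mu.
- by rewrite inE arr_update => /negPf ->.
- by rewrite mem_cat negb_or => /andP[? ?]; rewrite IH2 // IH1.
- by rewrite mem_cat negb_or => /andP[? ?]; case: ifP => _; rewrite ?IH1 ?IH2.
rewrite inE negb_or => /andP[/negPf ax ac]; rewrite arr_update ax /=.
by elim: (arr mu b 0) => //= N IHN; rewrite IH // arr_update ax.
Qed.

(* [Inv j] may not depend on the counter [x], whose final value is [N]. *)
Lemma sem_CFor (Inv : nat -> memory -> Prop) x b c mu N :
  arr mu b 0 = N -> x \notin writes c -> Inv 0 mu ->
  (forall j nu k, Inv j nu -> Inv j (update nu (cell x 0) k)) ->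
  (forall j nu, j < N -> arr nu x 0 = j ->
     (forall a i, a \notin x :: writes c -> arr nu a i = arr mu a i) ->
     Inv j nu -> Inv j.+1 (sem c nu)) ->
  Inv N (sem (CFor x b c) mu).
Proof.
move=> <- xc I0 Ix IS /=; apply: (Ix).
set f := fun j nu => sem c _.
have fr k a i : a \notin x :: writes c -> arr (iteri k f mu) a i = arr mu a i.
  rewrite inE negb_or => /andP[/negPf ax ac]; elim: k => //= k IH.
  by rewrite sem_frame // arr_update ax.
suff h k : k <= arr mu b 0 -> Inv k (iteri k f mu) by exact: h.
elim: k => //= k IH lt_k; apply: IS => //.
- by rewrite arr_update !eqxx.
- move=> a i ain; rewrite arr_update.
  by move: (ain); rewrite inE negb_or => /andP[/negPf -> _]; apply: fr.
by apply: Ix; apply: IH; apply: ltnW.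
Qed.

(** Stated for arbitrary programs, as it also serves the loops that read the input and write the
    output. *)
Lemma hoare_loop K S s x b body N (Inv : nat -> state -> Prop) :
  loop_weight x b <= K -> N <= S ->
  (forall j st, Inv j st -> arr (Defs.mem st) x 0 = j /\ arr (Defs.mem st) b 0 = N) ->
  (forall j, j < N -> hoare K s (Inv j) body
     (fun st => Inv j.+1 (State (update (Defs.mem st) (cell x 0) (arr (Defs.mem st) x 0).+1)
                                (input st) (output st)))) ->
  hoare K (2 + S * (2 + s))
    (fun st => Inv 0 (State (update (Defs.mem st) (cell x 0) 0) (input st) (output st)))
    (loop x b body) (Inv N).
Proof.
rewrite /loop_weight => le_K le_NS loopP bodyP.
apply: (@hoare_conseq K (1 + (N * (s + 1).+1).+1) _
   _ _ (Inv N) _ _ _ (fun st h => h) (fun st h => h)).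
  rewrite add1n add2n !ltnS leq_mul //; lia.
apply: hoare_Then; last first.
  apply: hoare_While loopP _; first lia.
  move=> j lt_jN; apply: hoare_Then (bodyP j lt_jN) _.
  have /= := @hoare_Store K (Addr x (Lit 0)) (Op Plus (Var x) (Lit 1)) (Inv j.+1).
  move=> h; apply: (hoare_conseq _ _ (fun st q => q) (h _ _)) => //; last by move: le_K => /=; lia.
  move=> st; rewrite -/(cell _ _) -/(arr _ _ _) addn1; exact.
by apply: hoare_Store => //; move: le_K => /=; lia.
Qed.

(** The postcondition determines the whole state, so that the algorithm can be verified on [sem]
    alone, without time or input and output. *)
Lemma hoare_compile K S c mu xs ys : wf c -> weight c <= K -> 0 < K ->
  arr mu vM 0 <= S -> arr mu vN 0 <= S ->
  hoare K (steps S c) (fun st => st = State mu xs ys) (compile c)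
    (fun st => st = State (sem c mu) xs ys).
Proof.
move=> wfc le_K K0.
have fr c' nu : wf c' -> (arr (sem c' nu) vM 0 = arr nu vM 0) * (arr (sem c' nu) vN 0 = arr nu vN 0).
  have wr : wf c' -> forall a, a \in writes c' -> a \notin [:: vM; vN].
    elim: c' {nu} => //= [a _ e /andP[+ _] a'|c1 IH1 c2 IH2|_ c1 IH1 c2 IH2|x b c1 IH].
    - by rewrite [a' \in _]inE => + /eqP ->.
    - by move=> /andP[/IH1 h1 /IH2 h2] a; rewrite mem_cat => /orP[/h1|/h2].
    - by move=> /andP[/IH1 h1 /IH2 h2] a; rewrite mem_cat => /orP[/h1|/h2].
    by move=> /and4P[_ xn _ /IH h] a; rewrite inE => /predU1P[->|/h].
  move=> wfc'; split; apply: sem_frame; apply/negP => /(wr wfc').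
    by [].
  by [].
elim: c mu wfc le_K => [|a i e|c1 IH1 c2 IH2|e c1 IH1 c2 IH2|x b c IH] mu.
- by move=> *; apply: hoare_Skip.
- move=> /= /andP[_ lin] le_K _ _.
  apply: (hoare_conseq (leqnn _) _ (fun st q => q)
            (@hoare_Store K (Addr a i) e _ le_K lin)).
  by move=> st ->.
- move=> /= /andP[wf1 wf2] le_K leM leN; apply: hoare_Then (IH1 mu wf1 _ leM leN) _.
    by lia.
  by apply: IH2 => //; rewrite ?fr //; lia.
- move=> /= /andP[wf1 wf2] le_K leM leN; apply: hoare_If; first lia.
    by move=> L st [-> /= ->]; apply: IH1 => //; lia.
  by move=> L st [-> /= e0]; rewrite e0 /=; apply: IH2 => //; lia.
move=> /= /and4P[bMN xMN xc wfc] le_K leM leN.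
have [xM xN] : (0 == x) = false /\ (1 == x) = false.
  by move: xMN; rewrite !inE negb_or ![x == _]eq_sym => /andP[/negPf ? /negPf].
set f := fun j nu => sem c _.
have frM k : arr (iteri k f mu) vM 0 = arr mu vM 0.
  by elim: k => //= k IHk; rewrite fr // arr_update xM.
have frN k : arr (iteri k f mu) vN 0 = arr mu vN 0.
  by elim: k => //= k IHk; rewrite fr // arr_update xN.
have [frb bx] : (forall k, arr (iteri k f mu) b 0 = arr mu b 0) /\ (b == x) = false.
  by move: bMN; rewrite !inE => /orP[] /eqP ->.
pose Inv j st := st = State (update (iteri j f mu) (cell x 0) j) xs ys.
have le_NS : arr mu b 0 <= S by move: bMN; rewrite !inE => /orP[] /eqP ->.
apply: (@hoare_conseq K (2 + S * (2 + steps S c)) _ _ _ (Inv (arr mu b 0)) _ _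
  (leqnn _) _ (fun st h => h) (hoare_loop (Inv := Inv) _ le_NS _ _)).
- by move=> st ->.
- lia.
- by move=> j st ->; rewrite /= !arr_update !eqxx bx frb.
move=> j lt_j.
apply: (hoare_conseq (leqnn _) _ _ (IH (update (iteri j f mu) (cell x 0) j) wfc _ _ _)).
- by move=> st ->.
- by move=> st ->; rewrite /Inv /= sem_frame // arr_update !eqxx.
- lia.
- by rewrite arr_update xM /= frM.
- by rewrite arr_update xN /= frN.
Qed.

Lemma steps_poly c : exists k d, forall S, 0 < S -> steps S c <= k * S ^ d.
Proof.
have mono k k' d d' S : 0 < S -> k <= k' -> d <= d' -> k * S ^ d <= k' * S ^ d'.
  by move=> S0 le_k le_d; rewrite leq_mul // leq_pexp2l.
elim: c => [|a i e|c1 [k1 [d1 h1]] c2 [k2 [d2 h2]]|e c1 [k1 [d1 h1]] c2 [k2 [d2 h2]]|x b c [k [d h]]].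
- by exists 1, 0 => S _; rewrite expn0.
- by exists 1, 0 => S _; rewrite expn0.
- exists (k1 + k2), (d1 + d2) => S S0; rewrite mulnDl leq_add //.
    by apply: leq_trans (h1 S S0) _; rewrite mono // leq_addr.
  by apply: leq_trans (h2 S S0) _; rewrite mono // leq_addl.
- exists (1 + k1 + k2), (d1 + d2) => S S0; rewrite !mulnDl !leq_add //.
  + by rewrite mul1n expn_gt0 S0.
  + by apply: leq_trans (h1 S S0) _; rewrite mono // leq_addr.
  by apply: leq_trans (h2 S S0) _; rewrite mono // leq_addl.
exists (2 + (2 + k)), d.+1 => S S0 /=; rewrite mulnDl leq_add //.
  by rewrite -[leqLHS]muln1 leq_mul // expn_gt0 S0.
rewrite expnS mulnCA leq_mul // mulnDl leq_add ?h //.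
by rewrite -[leqLHS]muln1 leq_mul // expn_gt0 S0.
Qed.

(** * The algorithm *)

(* [vX] holds the input rows, of which [vQ] entries have been read, and [vPos] the
   inverse rankings. [vB] is the guessed score, [vD] the required and [vU] the
   missing coverage, [vT] the current shift-action; [vBest] is the cheapest one so
   far, [vBc] its cost. [vBi], [vBk], [vBg], [vBp] are the voter, shift, gain and
   price of the best item found, [vG] the gain of the item at hand, [vS] a sum
   over voters, [vR] the number of third candidates that hold down [vA]; the rest
   are loop counters. *)
Local Notation vP := 2 (only parsing).
Local Notation vX := 3 (only parsing).
Local Notation vQ := 4 (only parsing).
Local Notation vPos := 5 (only parsing).
Local Notation vT := 6 (only parsing).
Local Notation vBest := 7 (only parsing).
Local Notation vD := 8 (only parsing).
Local Notation vU := 9 (only parsing).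
Local Notation vBc := 10 (only parsing).
Local Notation vS := 11 (only parsing).
Local Notation vR := 12 (only parsing).
Local Notation vG := 13 (only parsing).
Local Notation vBg := 14 (only parsing).
Local Notation vBp := 15 (only parsing).
Local Notation vBi := 16 (only parsing).
Local Notation vBk := 17 (only parsing).
Local Notation vB := 18 (only parsing).
Local Notation vA := 19 (only parsing).
Local Notation vI := 20 (only parsing).
Local Notation vJ := 21 (only parsing).
Local Notation vC := 22 (only parsing).
Local Notation vR1 := 23 (only parsing).
Local Notation vR2 := 24 (only parsing).

Lemma sem_CSeq c1 c2 mu : sem (CSeq c1 c2) mu = sem c2 (sem c1 mu).
Proof. by []. Qed.

Lemma sem_CSet a i e mu :
  sem (CSet a i e) mu = update mu (cell a (eval mu i)) (eval mu e).
Proof. by []. Qed.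

Lemma sem_CIf e c1 c2 mu :
  sem (CIf e c1 c2) mu = if eval mu e != 0 then sem c1 mu else sem c2 mu.
Proof. by []. Qed.

Lemma eval_Op mu o e1 e2 : eval mu (Op o e1 e2) = eval_op o (eval mu e1) (eval mu e2).
Proof. by []. Qed.

Lemma eval_Lit mu x : eval mu (Lit x) = x.
Proof. by []. Qed.

Definition set_var a e := CSet a (Lit 0) e.

Lemma sem_set_var a e mu : sem (set_var a e) mu = update mu (cell a 0) (eval mu e).
Proof. by []. Qed.

#[local] Opaque sem cell.

(** * Tests, sums and the commands of the algorithm *)

Definition Lt e1 e2 := Op Minus e2 e1.
Definition Le e1 e2 := Op Minus (Op Plus e2 (Lit 1)) e1.
Definition Neq e1 e2 := Op Plus (Op Minus e1 e2) (Op Minus e2 e1).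
Definition And e1 e2 := Op Times e1 e2.
Definition Not e := Op Minus (Lit 1) e.

Lemma eval_Lt mu e1 e2 : (eval mu (Lt e1 e2) != 0) = (eval mu e1 < eval mu e2).
Proof. by rewrite /Lt eval_Op /=; lia. Qed.

Lemma eval_Le mu e1 e2 : (eval mu (Le e1 e2) != 0) = (eval mu e1 <= eval mu e2).
Proof. by rewrite /Le !eval_Op eval_Lit /=; lia. Qed.

Lemma eval_Neq mu e1 e2 : (eval mu (Neq e1 e2) != 0) = (eval mu e1 != eval mu e2).
Proof. by rewrite /Neq !eval_Op /=; lia. Qed.

Lemma eval_And mu e1 e2 :
  (eval mu (And e1 e2) != 0) = (eval mu e1 != 0) && (eval mu e2 != 0).
Proof. by rewrite /And eval_Op /= muln_eq0 negb_or. Qed.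

Lemma eval_Not mu e : (eval mu (Not e) != 0) = ~~ (eval mu e != 0).
Proof. by rewrite /Not eval_Op eval_Lit /=; lia. Qed.

Definition eval_bool := (eval_Lt, eval_Le, eval_Neq, eval_And, eval_Not).

Definition csum s x b e : cmd :=
  CSeq (set_var s (Lit 0)) (CFor x b (set_var s (Op Plus (Var s) e))).

Definition ccount s x b e : cmd :=
  CSeq (set_var s (Lit 0)) (CFor x b (CIf e (set_var s (Op Plus (Var s) (Lit 1))) CSkip)).

Lemma csumP s x b e (F : nat -> nat) N mu : s != x -> b != s -> arr mu b 0 = N ->
  (forall j nu, j < N -> arr nu x 0 = j ->
     (forall a i, a \notin [:: s; x] -> arr nu a i = arr mu a i) -> eval nu e = F j) ->
  arr (sem (csum s x b e) mu) s 0 = \sum_(j < N) F j.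
Proof.
move=> sx bs eN eF; rewrite /csum sem_CSeq.
set mu1 := sem (set_var s (Lit 0)) mu.
have mu1E a i : a != s -> arr mu1 a i = arr mu a i.
  by move=> /negPf as_; rewrite /mu1 arr_update as_.
apply: (@sem_CFor (fun j nu => arr nu s 0 = \sum_(i < j) F i)).
- by rewrite mu1E.
- by rewrite inE eq_sym.
- by rewrite big_ord0 arr_update !eqxx.
- by move=> j nu k; rewrite arr_update (negPf sx).
move=> j nu lt_j xj fr IH; rewrite sem_set_var arr_update !eqxx eval_Op eval_Var /=.
rewrite big_ord_recr /= -IH; congr (_ + _); apply: eF => //.
move=> a i; rewrite !inE !negb_or => /andP[as_ ax]; rewrite fr ?mu1E //.
by rewrite !inE negb_or ax.
Qed.

Lemma ccountP s x b e (F : nat -> bool) N mu : s != x -> b != s -> arr mu b 0 = N ->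
  (forall j nu, j < N -> arr nu x 0 = j ->
     (forall a i, a \notin [:: s; x] -> arr nu a i = arr mu a i) ->
     (eval nu e != 0) = F j) ->
  arr (sem (ccount s x b e) mu) s 0 = \sum_(j < N) F j.
Proof.
move=> sx bs eN eF; rewrite /ccount sem_CSeq.
set mu1 := sem (set_var s (Lit 0)) mu.
have mu1E a i : a != s -> arr mu1 a i = arr mu a i.
  by move=> /negPf as_; rewrite /mu1 arr_update as_.
apply: (@sem_CFor (fun j nu => arr nu s 0 = \sum_(i < j) F i)).
- by rewrite mu1E.
- by rewrite /= inE eq_sym.
- by rewrite big_ord0 arr_update !eqxx.
- by move=> j nu k; rewrite arr_update (negPf sx).
move=> j nu lt_j xj fr IH; rewrite sem_CIf (eF j) //.
- rewrite big_ord_recr [RHS]/= -IH; case: (F j); last by rewrite addn0.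
  by rewrite sem_set_var arr_update !eqxx.
move=> a i; rewrite !inE !negb_or => /andP[as_ ax]; rewrite fr ?mu1E //.
by rewrite !inE negb_or ax as_.
Qed.

Definition eIndex i j := Op Plus (Op Times i (Var vM)) j.
Definition ePos i c := Arr vPos (eIndex i c).
Definition ePrice i k :=
  Arr vX (Op Plus (Op Plus (Op Times i (Op Plus (Var vM) (Var vM))) (Var vM)) k).
Definition eCovers i k c := Le (ePos i (Var vP)) (Op Plus (ePos i c) k).

Definition cPos : cmd :=
  CFor vI vN (CFor vJ vM
    (CSet vPos (eIndex (Var vI)
       (Arr vX (Op Plus (Op Times (Var vI) (Op Plus (Var vM) (Var vM))) (Var vJ))))
       (Var vJ))).

(** Shifting by [m - 1] puts [p] on top of every vote: a feasible solution that gives the first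
    comparison a cost to beat. *)
Definition cInit : cmd :=
  CSeq (CFor vI vN (CSet vBest (Var vI) (Op Minus (Var vM) (Lit 1))))
       (csum vBc vI vN (ePrice (Var vI) (Op Minus (Var vM) (Lit 1)))).

Definition cRivals : cmd :=
  CSeq (set_var vR (Lit 0))
  (CFor vC vM
    (CSeq (ccount vS vI vN (Lt (ePos (Var vI) (Var vA)) (ePos (Var vI) (Var vC))))
    (CIf (And (Neq (Var vC) (Var vP))
              (And (Neq (Var vC) (Var vA)) (Le (Var vS) (Var vB))))
         (set_var vR (Op Plus (Var vR) (Lit 1))) CSkip))).

(** With truncated subtraction, [B + (n - B - B)] is the maximum of [B] and [n - B]. *)
Definition cDemand : cmd :=
  CFor vA vM
    (CSeq cRivals
    (CIf (Var vR) (CSet vD (Var vA) (Var vB))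
      (CSet vD (Var vA)
         (Op Plus (Var vB) (Op Minus (Op Minus (Var vN) (Var vB)) (Var vB)))))).

Definition cNeed : cmd :=
  CFor vC vM
    (CSeq (ccount vS vI vN (eCovers (Var vI) (Arr vT (Var vI)) (Var vC)))
          (CSet vU (Var vC) (Op Minus (Arr vD (Var vC)) (Var vS)))).

Definition cGain : cmd :=
  ccount vG vC vM
    (And (Arr vU (Var vC))
         (And (Not (eCovers (Var vI) (Arr vT (Var vI)) (Var vC)))
              (eCovers (Var vI) (Var vJ) (Var vC)))).

(** The cross products occur only in the test; what is stored afterwards is copied from cells. *)
Definition cCompare : cmd :=
  CIf (Lt (Op Times (ePrice (Var vI) (Var vJ)) (Var vBg)) (Op Times (Var vBp) (Var vG)))
    (CSeq (set_var vBi (Var vI)) (CSeq (set_var vBk (Var vJ))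
    (CSeq (set_var vBg (Var vG)) (set_var vBp (ePrice (Var vI) (Var vJ))))))
    CSkip.

(* The gain 0 and price 1 stand for "nothing found": their ratio is infinite. *)
Definition cSearch : cmd :=
  CSeq (CSeq (set_var vBg (Lit 0)) (set_var vBp (Lit 1)))
       (CFor vI vN (CFor vJ vM (CSeq cGain cCompare))).

Definition cRound : cmd :=
  CSeq (CSeq cNeed cSearch) (CIf (Var vBg) (CSet vT (Var vBi) (Var vBk)) CSkip).

Definition cGreedy : cmd :=
  CSeq (CFor vI vN (CSet vT (Var vI) (Lit 0)))
       (CFor vR1 vN (CFor vR2 vM cRound)).

Definition cKeep : cmd :=
  CSeq (csum vS vI vN (ePrice (Var vI) (Arr vT (Var vI))))
  (CIf (Lt (Var vS) (Var vBc))
     (CSeq (set_var vBc (Var vS)) (CFor vI vN (CSet vBest (Var vI) (Arr vT (Var vI)))))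
     CSkip).

Definition cSolve : cmd :=
  CSeq cPos (CSeq cInit (CFor vB vN (CSeq cDemand (CSeq cGreedy cKeep)))).

Lemma wf_cSolve : wf cSolve. Proof. by []. Qed.

(** * Correctness of the algorithm *)

Section Solve.
Variables (n m p : nat) (pos pr : nat -> nat -> nat).

Notation coverage := (coverage n p pos).
Notation gain := (gain n m p pos).
Notation meets := (meets n m p pos).
Notation deficit := (deficit n m p pos).
Notation cost := (cost n pr).

Definition env mu : Prop :=
  [/\ [/\ arr mu vM 0 = m, arr mu vN 0 = n & arr mu vP 0 = p],
      forall i c, i < n -> c < m -> arr mu vPos (i * m + c) = pos i c
    & forall i k, i < n -> k < m -> arr mu vX (i * (m + m) + m + k) = pr i k].

Lemma env_eq mu nu :
  (forall a i, a \in [:: vM; vN; vP; vPos; vX] -> arr nu a i = arr mu a i) ->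
  env mu -> env nu.
Proof.
move=> e [[eM eN eP] ePs eX]; split; [split | move=> i c | move=> i c];
  by rewrite e //; apply: ePs || apply: eX.
Qed.

Lemma env_frame (ws : seq nat) mu nu : all (fun a => a \notin ws) [:: vM; vN; vP; vPos; vX] ->
  (forall a i, a \notin ws -> arr nu a i = arr mu a i) -> env mu -> env nu.
Proof. by move=> /allP h fr; apply: env_eq => a i /h /fr. Qed.

Lemma env_sem c mu :
  all (fun a => a \notin writes c) [:: vM; vN; vP; vPos; vX] -> env mu -> env (sem c mu).
Proof.
by move=> /allP h; apply: env_eq => a i ain; apply: sem_frame; apply: h.
Qed.

Lemma env_update mu a i x : a \notin [:: vM; vN; vP; vPos; vX] ->
  env mu -> env (update mu (cell a i) x).
Proof.
move=> ain; apply: env_eq => b j bin; rewrite arr_update.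
by case: eqP => //= e; rewrite e (negPf ain) in bin.
Qed.

Lemma cPosP (row : nat -> nat -> nat) mu :
  arr mu vM 0 = m -> arr mu vN 0 = n -> arr mu vP 0 = p ->
  (forall i j, i < n -> j < m -> arr mu vX (i * (m + m) + j) = row i j) ->
  (forall i k, i < n -> k < m -> arr mu vX (i * (m + m) + m + k) = pr i k) ->
  (forall i j, i < n -> j < m -> row i j < m /\ pos i (row i j) = j) ->
  (forall i c, i < n -> c < m -> pos i c < m /\ row i (pos i c) = c) ->
  env (sem cPos mu).
Proof.
move=> eM eN eP eRow ePr rowK posK.
have idx_inj i c i' c' : c < m -> c' < m ->
    (i * m + c == i' * m + c') = (i == i') && (c == c').
  move=> lt_c lt_c'; apply/eqP/andP => [e | [/eqP -> /eqP ->] //].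
  have ei : i = i' by nia.
  by split; apply/eqP => //; move: e; rewrite ei; apply: addnI.
split; first by split; rewrite sem_frame.
  suff h : forall i c, i < n -> c < m -> arr (sem cPos mu) vPos (i * m + c) = pos i c by [].
  apply: (@sem_CFor (fun i nu => forall i' c, i' < i -> c < m ->
    arr nu vPos (i' * m + c) = pos i' c)) => //.
    by move=> j nu k IH i c lt_i lt_c; rewrite arr_update IH.
  move=> i nu lt_i ei fr IH.
  set xi := sem _ nu.
  (* Row [i] is filled in the order of the ranking rather than of the candidates, so the inner
     invariant speaks of [row i j]; [posK] then reaches every candidate. *)
  suff [h1 h2] : (forall i' c, i' < i -> c < m -> arr xi vPos (i' * m + c) = pos i' c) /\
      (forall j, j < m -> arr xi vPos (i * m + row i j) = j).
    move=> i' c; rewrite ltnS leq_eqVlt => /predU1P[-> | lt_i'] lt_c; last exact: h1.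
    by have [lt_pos rowpos] := posK i c lt_i lt_c; rewrite -{1}rowpos h2.
  apply: (@sem_CFor (fun j xi =>
    (forall i' c, i' < i -> c < m -> arr xi vPos (i' * m + c) = pos i' c) /\
    (forall j', j' < j -> arr xi vPos (i * m + row i j') = j'))) => //.
  - by rewrite fr.
  - move=> j ze k [h1 h2]; split=> [i' c lt_i' lt_c | j' lt_j'].
      by rewrite arr_update h1.
    by rewrite arr_update h2.
  move=> j ze lt_j ej fr2 [h1 h2].
  have eI : arr ze vI 0 = i by rewrite fr2.
  have eM2 : arr ze vM 0 = m by rewrite fr2 // fr.
  have [lt_row posrow] := rowK i j lt_i lt_j.
  have eX : eval ze (Arr vX (Op Plus (Op Times (Var vI) (Op Plus (Var vM) (Var vM)))
      (Var vJ))) = row i j.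
    by rewrite eval_Arr !eval_Op !eval_Var eI eM2 ej /= fr2 // fr // eRow.
  have eA : eval ze (eIndex (Var vI) (Arr vX (Op Plus (Op Times (Var vI)
      (Op Plus (Var vM) (Var vM))) (Var vJ)))) = i * m + row i j.
    by rewrite /eIndex eval_Op eX eval_Op !eval_Var eI eM2.
  rewrite sem_CSet eA eval_Var ej; split=> [i' c lt_i' lt_c | j' lt_j'].
    by rewrite arr_update idx_inj // (ltn_eqF lt_i') /= h1.
  rewrite ltnS in lt_j'; have lt_jm := leq_ltn_trans lt_j' lt_j.
  have [lt_row' posrow'] := rowK i j' lt_i lt_jm.
  rewrite arr_update idx_inj // !eqxx /=; case: eqP => [e | ne].
    by rewrite -posrow -posrow' e.
  by apply: h2; rewrite ltn_neqAle lt_j' andbT; apply/eqP => e; case: ne; rewrite e.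
by move=> i k lt_i lt_k; rewrite sem_frame // ePr.
Qed.

Lemma eval_ePos mu i c : env mu -> eval mu i < n -> eval mu c < m ->
  eval mu (ePos i c) = pos (eval mu i) (eval mu c).
Proof.
move=> [[eM _ _] ePs _] lt_i lt_c.
by rewrite /ePos eval_Arr /eIndex !eval_Op eval_Var eM ePs.
Qed.

Lemma eval_ePrice mu i k : env mu -> eval mu i < n -> eval mu k < m ->
  eval mu (ePrice i k) = pr (eval mu i) (eval mu k).
Proof.
move=> [[eM _ _] _ eX] lt_i lt_k.
by rewrite /ePrice eval_Arr !eval_Op !eval_Var eM eX.
Qed.

Hypothesis lt_pm : p < m.

Lemma eval_eCovers mu i k c : env mu -> eval mu i < n -> eval mu c < m ->
  (eval mu (eCovers i k c) != 0) = covers p pos (eval mu i) (eval mu k) (eval mu c).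
Proof.
move=> E lt_i lt_c; have [[_ _ eP] _ _] := E.
by rewrite /eCovers eval_Le eval_Op !eval_ePos // eval_Var eP.
Qed.

Definition supporters a b : nat := \sum_(i < n) (pos i a < pos i b).
Definition rivals B a : nat := \sum_(b < m) [&& val b != p, val b != a & supporters a b <= B].
Definition requirement B a : nat := if rivals B a != 0 then B else B + (n - B - B).

Lemma cRivalsP mu B a : env mu -> arr mu vB 0 = B -> arr mu vA 0 = a -> a < m ->
  arr (sem cRivals mu) vR 0 = rivals B a.
Proof.
move=> E eB eA lt_a; rewrite /cRivals sem_CSeq.
have E1 : env (sem (set_var vR (Lit 0)) mu) by apply: env_sem E.
have [[eM _ _] _ _] := E1.
apply: (@sem_CFor (fun j nu => arr nu vR 0 =
  \sum_(b < j) [&& val b != p, val b != a & supporters a b <= B])) => //.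
  by rewrite big_ord0.
move=> j nu lt_j ej fr IH.
have E2 : env nu by apply: (env_frame _ fr).
have eB2 : arr nu vB 0 = B by rewrite fr // sem_frame.
have eA2 : arr nu vA 0 = a by rewrite fr // sem_frame.
rewrite sem_CSeq; set nu1 := sem (ccount _ _ _ _) nu.
have E3 : env nu1 by apply: env_sem E2.
have eS : arr nu1 vS 0 = supporters a j.
  have [[_ eN _] _ _] := E2.
  apply: (@ccountP _ _ _ _ (fun i => pos i a < pos i j)) => // i xi lt_i ei fri.
  have Ei : env xi by apply: (env_frame _ fri).
  rewrite eval_Lt !eval_ePos // !eval_Var ?ei ?fri // ?eA2 ?ej //.
rewrite sem_CIf !eval_bool !eval_Var eS.
have -> : arr nu1 vC 0 = j by rewrite sem_frame.
have -> : arr nu1 vP 0 = p by case: E3 => [[]].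
have -> : arr nu1 vA 0 = a by rewrite sem_frame.
have -> : arr nu1 vB 0 = B by rewrite sem_frame.
have eR : arr nu1 vR 0 = arr nu vR 0 by rewrite sem_frame.
rewrite big_ord_recr [RHS]/= -IH; case: ifP => _; last by rewrite addn0.
by rewrite sem_set_var arr_update !eqxx eval_Op !eval_Var eval_Lit eR.
Qed.

Lemma cDemandP mu B : env mu -> arr mu vB 0 = B ->
  forall c, c < m -> arr (sem cDemand mu) vD c = requirement B c.
Proof.
move=> E eB; have [[eM _ _] _ _] := E.
apply: (@sem_CFor (fun j nu => forall c, c < j -> arr nu vD c = requirement B c)) => //.
  by move=> j nu k IH c lt_c; rewrite arr_update IH.
move=> j nu lt_j ej fr IH c; rewrite sem_CSeq.
have E2 : env nu by apply: (env_frame _ fr).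
have eB2 : arr nu vB 0 = B by rewrite fr.
have eR := cRivalsP E2 eB2 ej lt_j.
set nu1 := sem cRivals nu in eR *; have E3 : env nu1 by apply: env_sem E2.
have eB3 : arr nu1 vB 0 = B by rewrite sem_frame.
have eA3 : arr nu1 vA 0 = j by rewrite sem_frame.
have [[_ eN _] _ _] := E3.
rewrite ltnS leq_eqVlt sem_CIf eval_Var eR => /predU1P[-> | lt_cj].
  rewrite /requirement; case: ifP => _; rewrite sem_CSet arr_update eval_Var eA3 !eqxx.
    by rewrite eval_Var eB3.
  by rewrite !eval_Op !eval_Var eN eB3.
have ne : (c == j) = false by rewrite ltn_eqF.
have D2 : arr nu1 vD c = requirement B c by rewrite sem_frame // IH.
by case: ifP => _; rewrite sem_CSet arr_update eval_Var eA3 ne andbF.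
Qed.

Section Round.
Variables (d t : nat -> nat).

Definition represents mu : Prop :=
  [/\ env mu, forall c, c < m -> arr mu vD c = d c
    & forall i, i < n -> arr mu vT i = t i].

Lemma represents_frame (ws : seq nat) mu nu :
  all (fun a => a \notin ws) [:: vM; vN; vP; vPos; vX; vD; vT] ->
  (forall a i, a \notin ws -> arr nu a i = arr mu a i) -> represents mu -> represents nu.
Proof.
move=> /allP h fr [E eD eT]; split=> [|c lt_c|i lt_i].
- by apply: (env_frame _ fr) E; apply/allP => a ain; apply: h; apply: mem_subseq ain.
- by rewrite fr ?eD ?h.
by rewrite fr ?eT ?h.
Qed.

Lemma represents_sem c mu :
  all (fun a => a \notin writes c) [:: vM; vN; vP; vPos; vX; vD; vT] ->
  represents mu -> represents (sem c mu).
Proof. by move=> h; apply: represents_frame h _ => a i; apply: sem_frame. Qed.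

Lemma cNeedP mu : represents mu ->
  forall c, c < m -> arr (sem cNeed mu) vU c = d c - coverage t c.
Proof.
move=> rep; have [[[eM _ _] _ _] _ _] := rep.
apply: (@sem_CFor (fun j nu => forall c, c < j -> arr nu vU c = d c - coverage t c)) => //.
  by move=> j nu k IH c lt_c; rewrite arr_update IH.
move=> j nu lt_j ej fr IH c; rewrite sem_CSeq.
have rep2 : represents nu by apply: (represents_frame _ fr).
set nu1 := sem (ccount _ _ _ _) nu.
have [E3 eD3 eT3] : represents nu1 by apply: represents_sem rep2.
have eC3 : arr nu1 vC 0 = j by rewrite sem_frame.
have eS : arr nu1 vS 0 = coverage t j.
  have [[[_ eN _] _ _] _ _] := rep2.
  apply: (@ccountP _ _ _ _ (fun i => covers p pos i (t i) j)) => // i xi lt_i ei fri.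
  have [Ei _ eTi] : represents xi by apply: (represents_frame _ fri).
  have eCi : arr xi vC 0 = j by rewrite fri.
  by rewrite eval_eCovers // !eval_Var ?eval_Arr ?eval_Var ?ei ?eCi // eTi.
rewrite ltnS leq_eqVlt sem_CSet arr_update eval_Var eC3 => /predU1P[-> | lt_cj].
  by rewrite !eqxx eval_Op !eval_Var eval_Arr ?eval_Var eC3 eS eD3.
by rewrite (ltn_eqF lt_cj) andbF sem_frame // IH.
Qed.

Lemma cGainP mu i k : represents mu -> i < n ->
  (forall c, c < m -> arr mu vU c = d c - coverage t c) ->
  arr mu vI 0 = i -> arr mu vJ 0 = k ->
  arr (sem cGain mu) vG 0 = gain d t i k.
Proof.
move=> rep lt_in eU eI eJ; have [[[eM _ _] _ _] _ _] := rep.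
apply: (@ccountP _ _ _ _ (fun c => [&& coverage t c < d c,
  ~~ covers p pos i (t i) c & covers p pos i k c])) => // c nu lt_c ec fr.
have [E _ eT] : represents nu by apply: (represents_frame _ fr).
have eI2 : arr nu vI 0 = i by rewrite fr.
have eJ2 : arr nu vJ 0 = k by rewrite fr.
rewrite !eval_And eval_Not !eval_eCovers // !eval_Var ?eval_Arr ?eval_Var ?eI2 ?ec // eJ2 eT //.
by rewrite fr // eU // subn_eq0 -ltnNge.
Qed.

(* Ratios of price to gain are compared by cross-multiplication. *)
Definition best_so_far (seen : nat -> nat -> bool) mu : Prop :=
  let g := arr mu vBg 0 in
  (if g == 0 then arr mu vBp 0 = 1 else
   [/\ arr mu vBi 0 < n, arr mu vBk 0 < m, g = gain d t (arr mu vBi 0) (arr mu vBk 0)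
     & arr mu vBp 0 = pr (arr mu vBi 0) (arr mu vBk 0)]) /\
  forall i k, i < n -> k < m -> seen i k ->
    arr mu vBp 0 * gain d t i k <= pr i k * g.

Lemma best_so_far_eq (seen seen' : nat -> nat -> bool) mu nu :
  (forall i k, i < n -> k < m -> seen' i k -> seen i k) ->
  (forall a i, a \in [:: vBg; vBp; vBi; vBk] -> arr nu a i = arr mu a i) ->
  best_so_far seen mu -> best_so_far seen' nu.
Proof.
move=> le_seen e; rewrite /best_so_far !e // => -[cur le_all].
by split=> // i k lt_i lt_k /le_seen h; apply: le_all => //; apply: h.
Qed.

Lemma cCompareP (seen : nat -> nat -> bool) mu i k : env mu -> i < n -> k < m ->
  arr mu vI 0 = i -> arr mu vJ 0 = k -> arr mu vG 0 = gain d t i k ->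
  best_so_far seen mu ->
  best_so_far (fun i' k' => seen i' k' || (i' == i) && (k' == k)) (sem cCompare mu).
Proof.
move=> E lt_in lt_km eI eJ eG [cur le_all].
have ePr : eval mu (ePrice (Var vI) (Var vJ)) = pr i k.
  by rewrite eval_ePrice // !eval_Var ?eI ?eJ.
rewrite /cCompare sem_CIf eval_Lt !eval_Op ePr !eval_Var eG [eval_op _ _ _]/= [eval_op _ _ _]/=.
case: ltnP => [lt_r | ge_r]; last first.
  split=> // i' k' lt_i' lt_k' /orP[|/andP[/eqP -> /eqP ->] //].
  exact: le_all.
rewrite !sem_CSeq !sem_set_var.
have ePr' nu : env nu -> arr nu vI 0 = i -> arr nu vJ 0 = k ->
    eval nu (ePrice (Var vI) (Var vJ)) = pr i k.
  by move=> En eIn eJn; rewrite eval_ePrice // !eval_Var ?eIn ?eJn.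
rewrite ePr'; last by rewrite !arr_update.
- rewrite /best_so_far !(arr_update, eval_Var) /= eG eI eJ.
  (* By strictness of the comparison: with gain 0 its right-hand side would vanish. *)
  have g0 : 0 < gain d t i k by move: lt_r; case: (gain d t i k) => //; rewrite muln0.
  rewrite (gtn_eqF g0); split=> // i' k' lt_i' lt_k' /orP[h|/andP[/eqP -> /eqP ->] //].
  have := le_all i' k' lt_i' lt_k' h.
  (* Transitivity of the ratio order needs a positive old gain. If the old gain is 0, the recorded
     price is 1 and every item seen so far gains nothing. *)
  move: cur; case: eqVneq => [g00 | ng00 _]; last by rewrite -lt0n in ng00; nia.
  by rewrite g00 => ->; rewrite muln0 mul1n leqn0 => /eqP ->; rewrite muln0.
- by do 3 apply: env_update => //.
by rewrite !arr_update.
Qed.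

Lemma cSearchP mu : represents mu ->
  (forall c, c < m -> arr mu vU c = d c - coverage t c) ->
  best_so_far (fun _ _ => true) (sem cSearch mu).
Proof.
move=> rep eU; rewrite /cSearch sem_CSeq; set mu1 := sem _ mu.
have rep1 : represents mu1 by apply: represents_sem rep.
have eU1 c : c < m -> arr mu1 vU c = d c - coverage t c.
  by move=> lt_c; rewrite sem_frame // eU.
have [[[eM1 eN1 _] _ _] _ _] := rep1.
apply: (@best_so_far_eq (fun i k => i < n)) => //.
apply: (@sem_CFor (fun j nu => best_so_far (fun i k => i < j) nu)) => //.
move=> i nu lt_in eI fr IH.
have rep2 : represents nu by apply: (represents_frame _ fr).
have eM2 : arr nu vM 0 = m by rewrite fr.
apply: (@best_so_far_eq (fun i' k' => (i' < i) || (i' == i) && (k' < m))) => //.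
  by move=> i' k' _ lt_k'; rewrite ltnS leq_eqVlt lt_k' andbT orbC.
apply: (@sem_CFor (fun j nu => best_so_far (fun i' k' => (i' < i) || (i' == i) && (k' < j)) nu)) => //.
- by apply: best_so_far_eq IH => // i' k' _ _; rewrite andbF orbF.
move=> k xi lt_km eJ fr2 IH2; rewrite sem_CSeq.
have rep3 : represents xi by apply: (represents_frame _ fr2).
have eI3 : arr xi vI 0 = i by rewrite fr2.
have eG : arr (sem cGain xi) vG 0 = gain d t i k.
  by apply: cGainP => // c lt_c; rewrite fr2 // fr // eU1.
have [E4 _ _] : represents (sem cGain xi) by apply: represents_sem rep3.
apply: best_so_far_eq (@cCompareP (fun i' k' => (i' < i) || (i' == i) && (k' < k)) _ i k E4 lt_in lt_km _ _ eG _) => //.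
- move=> i' k' _ _; rewrite ltnS (leq_eqVlt k'); case: (i' < i) => //=.
  by case: (i' == i) => //=; rewrite orbC.
- by rewrite sem_frame.
- by rewrite sem_frame.
by apply: best_so_far_eq IH2 => // a l ain; rewrite sem_frame //; move: ain; rewrite !inE => /or4P[] /eqP ->.
Qed.

End Round.

Lemma cRoundP d t mu : represents d t mu ->
  exists2 t', represents d t' (sem cRound mu) &
    (t' = t /\ forall i k, i < n -> k < m -> gain d t i k = 0) \/
    exists i k, [/\ i < n, k < m, 0 < gain d t i k,
      forall j l, j < n -> l < m -> pr i k * gain d t j l <= pr j l * gain d t i k
    & t' = change t i k].
Proof.
move=> rep; rewrite /cRound !sem_CSeq.
have rep1 : represents d t (sem cNeed mu) by apply: represents_sem rep.
have [] := cSearchP rep1 (cNeedP rep).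
set mu2 := sem cSearch _; have rep2 : represents d t mu2 by apply: represents_sem rep1.
rewrite sem_CIf eval_Var; case: eqVneq => [g0 eBp | g0 [lt_i lt_k eg ep]] le_all.
  exists t => //; left; split=> // i k lt_i lt_k.
  by apply/eqP; move: (le_all i k lt_i lt_k isT); rewrite g0 eBp mul1n muln0 leqn0.
exists (change t (arr mu2 vBi 0) (arr mu2 vBk 0)).
  have [E eD eT] := rep2; rewrite sem_CSet !eval_Var; split.
  - by apply: env_update.
  - by move=> c lt_c; rewrite arr_update eD.
  by move=> i lt_i'; rewrite arr_update /change /=; case: ifP => // _; apply: eT.
right; exists (arr mu2 vBi 0), (arr mu2 vBk 0); split=> //.
  by rewrite -eg lt0n.
by move=> j l lt_j lt_l; have := le_all j l lt_j lt_l isT; rewrite ep eg.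
Qed.

Variable R : realType.
Hypothesis pos_lt : forall i, i < n -> pos i p < m.
Hypothesis pr0 : forall i, pr i 0 = 0.

Lemma last_meets d : (forall c, d c <= n) -> meets d (fun=> m.-1).
Proof.
move=> le_dn c lt_c; apply: leq_trans (le_dn c) _.
rewrite -[leqLHS]card_ord -sum1_card; apply: leq_sum => i _.
by rewrite /covers lt0b; have := pos_lt (ltn_ord i); lia.
Qed.

Definition near_optimal d t : Prop := forall ts, meets d ts ->
  (forall i, i < n -> ts i < m) -> ((cost t)%:R <= harmonic R m * (cost ts)%:R)%R.

(* A round either lowers the deficit or finds that it is 0, so [n * m] rounds
   meet the demand. *)
Definition progress d q t : Prop :=
  [/\ forall i, i < n -> t i < m,
      deficit d t = 0 \/ deficit d t + q <= n * m
    & forall ts, meets d ts -> (forall i, i < n -> ts i < m) ->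
        greedy_inv n m p pos pr R d ts t].

Lemma cRound_progress d q t mu : (forall c, d c <= n) ->
  represents d t mu -> progress d q t ->
  exists2 t', represents d t' (sem cRound mu) & progress d q.+1 t'.
Proof.
move=> le_dn rep [t_lt t_def t_inv].
have [t' rep' step] := cRoundP rep; exists t' => //.
case: step => [[-> g0] | [i [k [lt_i lt_k g_gt0 best ->]]]].
  split=> //; left; apply/eqP; rewrite -leqn0.
  (* The deficit is at most the joint gain of any feasible solution, here the full shifts, and all
     these gains are 0. *)
  apply: leq_trans (deficit_le_gain t (last_meets le_dn)) _.
  by rewrite leqn0 sum_nat_eq0; apply/forallP => i /=; rewrite g0 //; lia.
have def := deficit_change m p pos d lt_i (ltnW (gain_gt0 g_gt0)).
split.
- by move=> j lt_j; rewrite /change; case: ifP => // _; apply: t_lt.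
- by right; case: t_def; lia.
by move=> ts ok ts_lt; apply: greedy_inv_change => //; apply: t_inv.
Qed.

Lemma cGreedyP d mu : (forall c, d c <= n) -> env mu ->
  (forall c, c < m -> arr mu vD c = d c) ->
  exists2 t, represents d t (sem cGreedy mu) &
    [/\ meets d t, forall i, i < n -> t i < m & near_optimal d t].
Proof.
move=> le_dn E eD; rewrite /cGreedy sem_CSeq; set mu1 := sem _ mu.
have rep1 : represents d (fun=> 0) mu1.
  split=> [|c lt_c|]; first exact: env_sem E.
    by rewrite sem_frame ?eD.
  have [[_ eN _] _ _] := E.
  apply: (@sem_CFor (fun j nu => forall i, i < j -> arr nu vT i = 0)) => //.
    by move=> j nu k IH i lt_i; rewrite arr_update IH.
  move=> j nu lt_j ej fr IH i; rewrite sem_CSet arr_update eval_Var ej /=.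
  by rewrite ltnS leq_eqVlt; case: eqP => //= _ /IH.
have prog0 : progress d 0 (fun=> 0).
  split; first by move=> *; lia.
    by right; rewrite addn0 deficit_le.
  by move=> ts ok ts_lt; apply: greedy_inv0.
have [[[eM eN _] _ _] _ _] := rep1.
pose Inv q nu := exists2 t, represents d t nu & progress d q t.
have Inv_update q nu x k : x \notin [:: vM; vN; vP; vPos; vX; vD; vT] ->
    Inv q nu -> Inv q (update nu (cell x 0) k).
  move=> xn [t rep prog]; exists t => //; apply: (represents_frame (ws := [:: x])) rep.
    by apply/allP => a ain; rewrite inE; apply: contraNneq xn => <-.
  by move=> a i; rewrite inE arr_update => /negPf ->.
have [] : Inv (n * m) (sem (CFor vR1 vN (CFor vR2 vM cRound)) mu1).
  apply: (@sem_CFor (fun i nu => Inv (i * m) nu)) => //.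
  - by exists (fun=> 0).
  - by move=> j nu k; apply: Inv_update.
  move=> i nu lt_i ei fr IH; rewrite mulSn addnC.
  apply: (@sem_CFor (fun j nu => Inv (i * m + j) nu)) => //.
  - by rewrite fr.
  - by rewrite addn0.
  - by move=> j xi k; apply: Inv_update.
  move=> j xi lt_j ej fr2 [t rep prog]; rewrite addnS.
  by have [t' rep' prog'] := cRound_progress le_dn rep prog; exists t'.
move=> t rep [t_lt t_def t_inv]; exists t => //.
have def0 : deficit d t = 0 by case: t_def => //; lia.
split=> //; first exact: deficit0 def0.
by move=> ts ok ts_lt; apply: greedy_inv_le (t_inv ts ok ts_lt).
Qed.

Definition stores b mu : Prop :=
  (forall i, i < n -> arr mu vBest i = b i) /\ arr mu vBc 0 = cost b.

Lemma cKeepP d t b mu : represents d t mu -> (forall i, i < n -> t i < m) ->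
  stores b mu ->
  exists2 b', stores b' (sem cKeep mu) &
    [/\ b' = b \/ b' = t, cost b' <= cost b & cost b' <= cost t].
Proof.
move=> rep t_lt [eb ebc]; rewrite /cKeep sem_CSeq; set mu1 := sem _ mu.
have rep1 : represents d t mu1 by apply: represents_sem rep.
have eb1 i : i < n -> arr mu1 vBest i = b i by move=> lt_i; rewrite sem_frame ?eb.
have ebc1 : arr mu1 vBc 0 = cost b by rewrite sem_frame.
have [[[eM eN _] _ _] _ _] := rep.
have eS : arr mu1 vS 0 = cost t.
  apply: (@csumP _ _ _ _ (fun i => pr i (t i))) => // i nu lt_i ei fr.
  have [Ei _ eTi] : represents d t nu by apply: (represents_frame _ fr).
  by rewrite eval_ePrice // ?eval_Var ?eval_Arr ?eval_Var ?ei ?eTi // t_lt.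
rewrite sem_CIf eval_Lt !eval_Var eS ebc1; case: ltnP => [lt_tb | le_bt]; last first.
  by exists b => //; split=> //; left.
exists t; last by split=> //; [right | apply: ltnW].
rewrite sem_CSeq; set mu2 := sem _ mu1.
have rep2 : represents d t mu2 by apply: represents_sem rep1.
split; last by rewrite sem_frame // /mu2 sem_set_var arr_update !eqxx eval_Var.
have [[[_ eN2 _] _ _] _ eT2] := rep2.
apply: (@sem_CFor (fun j nu => forall i, i < j -> arr nu vBest i = t i)) => //.
  by move=> j nu k IH i lt_i; rewrite arr_update IH.
move=> j nu lt_j ej fr IH i; rewrite sem_CSet arr_update eval_Arr !eval_Var ej /=.
by rewrite ltnS leq_eqVlt; case: eqP => [-> _|_ /IH //]; rewrite fr // eT2.
Qed.

Lemma cInitP mu : env mu -> stores (fun=> m.-1) (sem cInit mu).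
Proof.
move=> E; rewrite /cInit sem_CSeq; set mu1 := sem _ mu.
have E1 : env mu1 by apply: env_sem E.
have [[eM eN _] _ _] := E; split.
  move=> i lt_i; rewrite sem_frame //; move: i lt_i.
  apply: (@sem_CFor (fun j nu => forall i, i < j -> arr nu vBest i = m.-1)) => //.
    by move=> j nu k IH i lt_i; rewrite arr_update IH.
  move=> j nu lt_j ej fr IH i.
  rewrite sem_CSet arr_update eval_Op !eval_Var eval_Lit ej fr // eM /= subn1.
  by rewrite ltnS leq_eqVlt; case: eqP => //= _ /IH.
have [[eM1 eN1 _] _ _] := E1.
apply: (@csumP _ _ _ _ (fun i => pr i m.-1)) => // i nu lt_i ei fr.
have Ei : env nu by apply: (env_frame _ fr).
have ek : eval nu (Op Minus (Var vM) (Lit 1)) = m.-1.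
  by rewrite eval_Op eval_Var eval_Lit fr // eM1 /= subn1.
by rewrite eval_ePrice // ?eval_Var ?ek ?ei //; lia.
Qed.

Lemma requirement_le B c : B <= n -> requirement B c <= n.
Proof.
move=> le_B; rewrite /requirement; case: ifP => // _.
by rewrite -[leqRHS](subnKC le_B) leq_add2l leq_subr.
Qed.

(** The result need not stem from the right guess. It meets the requirement of some [B], which makes
    it successful, while [near_optimal] concerns only its cost and is inherited from the greedy run
    of every [B]. *)
Lemma cSolveP mu : env (sem cPos mu) ->
  exists b, [/\ forall i, i < n -> arr (sem cSolve mu) vBest i = b i,
    exists2 B, B <= n & meets (requirement B) b
  & forall B, B < n -> near_optimal (requirement B) b].
Proof.
move=> E; rewrite /cSolve 2!sem_CSeq.
set mu1 := sem cInit _.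
have E1 : env mu1 by apply: env_sem E.
have [[eM eN _] _ _] := E1.
pose good q b := [/\ exists2 B, B <= n & meets (requirement B) b
  & forall B, B < q -> near_optimal (requirement B) b].
suff [b [eb _] [okb optb]] : exists2 b, stores b
    (sem (CFor vB vN (CSeq cDemand (CSeq cGreedy cKeep))) mu1) & good n b.
  by exists b.
apply: (@sem_CFor (fun q nu => exists2 b, stores b nu & good q b)) => //.
- exists (fun=> m.-1); first exact: cInitP.
  (* The full shifts meet every requirement; [B = 0] is a legitimate guess even for [n = 0]. *)
  by split=> //; exists 0 => //; apply: last_meets => c; apply: requirement_le.
- move=> q nu k [b [eb ebc] okb]; exists b => //.
  by split=> [i lt_i|]; rewrite arr_update // eb.
move=> q nu lt_q eq_ fr [b [eb ebc] [okb optb]]; rewrite 2!sem_CSeq.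
have E2 : env nu by apply: (env_frame _ fr).
have le_req c : requirement q c <= n by rewrite requirement_le // ltnW.
have E3 : env (sem cDemand nu) by apply: env_sem E2.
have [t rep [ok_t t_lt opt_t]] := cGreedyP le_req E3 (cDemandP E2 eq_).
have st_b : stores b (sem cGreedy (sem cDemand nu)).
  by split=> [i lt_i|]; rewrite sem_frame // sem_frame // eb.
have [b' st_b' [eb' le_b le_t]] := cKeepP rep t_lt st_b.
exists b' => //; split.
  by case: eb' => -> //; exists q; first exact: ltnW.
move=> B; rewrite ltnS leq_eqVlt => /predU1P[-> | lt_B] ts ok ts_lt.
  by apply: le_trans (opt_t ts ok ts_lt); rewrite ler_nat.
by apply: le_trans (optb B lt_B ts ok ts_lt); rewrite ler_nat.
Qed.

End Solve.

(** * Running it on an encoded instance *)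

Lemma nth_flatten_uniform (T : Type) (x : T) w (ss : seq (seq T)) i j :
  all (fun s => size s == w) ss -> j < w ->
  nth x (flatten ss) (i * w + j) = nth x (nth [::] ss i) j.
Proof.
elim: ss i => [|s ss IH] i; first by rewrite /= !nth_nil.
move=> /= /andP[/eqP size_s all_w] lt_j; rewrite nth_cat size_s.
case: i => [|i] /=; first by rewrite mul0n lt_j.
by rewrite -IH // ifN; [congr nth; lia | lia].
Qed.

Section Encoding.
Variable I : instance.
Let m := ncand I.
Let n := nvoter I.
Let p := target I.

Definition ranking i : seq nat :=
  if insub i is Some o then [seq val a | a <- tnth (votes I) o] else [::].
Definition position i c : nat := index c (ranking i).
Definition shift_price i k : nat := if insub i is Some o then @price I o k else 0.
Definition rows : seq (seq nat) :=
  [seq [seq val a | a <- tnth (votes I) i] ++ [seq price i k | k <- iota 0 m]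
  | i <- enum 'I_n].

Lemma ranking_ord (o : 'I_n) : ranking o = [seq val a | a <- tnth (votes I) o].
Proof. by rewrite /ranking valK. Qed.

Lemma shift_price_ord (o : 'I_n) k : shift_price o k = price o k.
Proof. by rewrite /shift_price valK. Qed.

Lemma position_ord (o : 'I_n) (c : 'I_m) :
  position o c = index c (tnth (votes I) o).
Proof. by rewrite /position ranking_ord index_map //; apply: val_inj. Qed.

Lemma size_ranking i : i < n -> size (ranking i) = m.
Proof.
move=> lt_i; rewrite (ranking_ord (Ordinal lt_i)) size_map.
by rewrite (perm_size (votesP _)) size_enum_ord.
Qed.

Lemma uniq_ranking i : uniq (ranking i).
Proof.
rewrite /ranking; case: insubP => // o _ _; rewrite map_inj_uniq; last exact: val_inj.
by rewrite (perm_uniq (votesP _)) enum_uniq.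
Qed.

Lemma mem_ranking i c : i < n -> (c \in ranking i) = (c < m).
Proof.
move=> lt_i; rewrite (ranking_ord (Ordinal lt_i)).
apply/mapP/idP; first by case=> a _ ->; apply: ltn_ord.
by move=> lt_c; exists (Ordinal lt_c) => //; rewrite (perm_mem (votesP _)) mem_enum.
Qed.

Lemma position_lt i c : i < n -> c < m -> position i c < m.
Proof.
by move=> lt_i lt_c; rewrite -(size_ranking lt_i) index_mem mem_ranking.
Qed.

Lemma shift_price0 i : shift_price i 0 = 0.
Proof. by rewrite /shift_price; case: insub => // o; rewrite price0. Qed.

Lemma nth_rows i : i < n ->
  nth [::] rows i = ranking i ++ [seq shift_price i k | k <- iota 0 m].
Proof.
move=> lt_i; rewrite (nth_map (Ordinal lt_i)) ?size_enum_ord //.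
have -> : nth (Ordinal lt_i) (enum 'I_n) i = Ordinal lt_i.
  by apply: ord_inj; rewrite nth_enum_ord.
rewrite (ranking_ord (Ordinal lt_i)); congr (_ ++ _).
by apply: eq_map => k; rewrite (shift_price_ord (Ordinal lt_i)).
Qed.

Lemma rows_size : all (fun s => size s == m + m) rows.
Proof.
apply/allP => s /mapP[o _ ->]; rewrite size_cat !size_map size_iota.
by rewrite (perm_size (votesP _)) size_enum_ord.
Qed.

Lemma nth_encoding_rank i j : i < n -> j < m ->
  nth 0 (flatten rows) (i * (m + m) + j) = nth 0 (ranking i) j.
Proof.
move=> lt_i lt_j; rewrite (nth_flatten_uniform _ _ rows_size) ?nth_rows //; last by lia.
by rewrite nth_cat size_ranking // lt_j.
Qed.

Lemma nth_encoding_price i k : i < n -> k < m ->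
  nth 0 (flatten rows) (i * (m + m) + m + k) = shift_price i k.
Proof.
move=> lt_i lt_k; rewrite -addnA (nth_flatten_uniform _ _ rows_size) ?nth_rows //; last by lia.
rewrite nth_cat size_ranking // ltnNge leq_addr /= addKn.
by rewrite (nth_map 0) ?size_iota // nth_iota.
Qed.

Lemma size_flatten_rows : size (flatten rows) = n * (m + m).
Proof.
have /all_pred1P : all (pred1 (m + m)) (shape rows).
  by rewrite all_map; apply: rows_size.
rewrite size_flatten => ->; rewrite sumn_nseq mulnC size_map size_map size_enum_ord //.
Qed.

Lemma encodeE : encode I = [:: m, n, val p & flatten rows].
Proof. by []. Qed.

(** The encoding has [3 + n * (m + m)] entries of at least one bit each, with [m] positive. *)
Lemma size_le_rep : 0 < n -> (m <= rep_size I) && (n <= rep_size I).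
Proof.
move=> n0; have m0 : 0 < m := leq_ltn_trans (leq0n _) (ltn_ord p).
have le_size : size (encode I) <= rep_size I.
  by rewrite -sum1_size; apply: leq_sum.
move: le_size; rewrite encodeE /= size_flatten_rows => le_size.
by apply/andP; split; nia.
Qed.

Lemma encode_lt x : x \in encode I -> x < 2 ^ rep_size I.
Proof.
move=> x_in; apply: leq_trans (lt_bitlen x) _; rewrite leq_exp2l //.
by rewrite /rep_size (big_rem x) //= leq_addr.
Qed.

Notation coverage := (coverage n p position).
Notation meets := (meets n m p position).
Notation cost := (cost n shift_price).
Notation requirement := (requirement n m p position).

Definition shift_action (t : nat -> nat) : n.-tuple nat := [tuple t i | i < n].

Lemma cost_shift_action t : shift_cost (shift_action t) = cost t.
Proof.
by apply: eq_bigr => i _; rewrite tnth_mktuple shift_price_ord.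
Qed.

(** Only the covering relations of [t] and [u] have to agree: in [opt_meets], [t] is [u] truncated
    at the top of each vote. *)
Lemma coverage_support (t : nat -> nat) (c : 'I_m) (u : n.-tuple nat) : c != p ->
  (forall i : 'I_n, covers p position i (t i) c = covers p position i (tnth u i) c) ->
  coverage t c = Defs.support (shf p (votes I) u) p c.
Proof.
move=> cp tu; rewrite support_target //; last exact: votesP.
by apply: eq_bigr => i _; rewrite tu /covers !position_ord.
Qed.

Lemma coverage_target t : coverage t p = n.
Proof.
rewrite -[RHS]card_ord -sum1_card; apply: eq_bigr => i _.
by rewrite /covers leq_addr.
Qed.

Lemma requirementE B (c : 'I_m) : requirement B c = demand p (votes I) B c.
Proof.
have sup (a b : 'I_m) : supporters n position a b = Defs.support (votes I) a b.
  rewrite /Defs.support count_tuple; apply: eq_bigr => i _.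
  by rewrite !position_ord.
rewrite /requirement /demand /rivals.
rewrite sum_nat_eq0 negb_forall.
have -> : [exists b : 'I_m, ~~ (true ==> ([&& val b != p, val b != c &
    supporters n position c b <= B] == 0 :> nat))] =
  [exists b, [&& b != p, b != c & Defs.support (votes I) c b <= B]].
  by apply: eq_existsb => b; rewrite implyTb eqb0 negbK sup.
by case: ifP => // _; lia.
Qed.

Lemma meets_successful B t : B <= n -> meets (requirement B) t ->
  successful (shift_action t).
Proof.
move=> le_Bn ok; apply: (demand_winner (@votesP I) le_Bn).
move=> c cp; rewrite -requirementE -(@coverage_support t) //; first exact: ok.
by move=> i; rewrite tnth_mktuple.
Qed.

Lemma opt_meets : 0 < n -> exists B ts, [/\ B < n, meets (requirement B) ts,
  forall i, i < n -> ts i < m & cost ts = opt I].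
Proof.
move=> n0; rewrite /opt; case: ex_minnP => k /asboolP[u [win cost_u]] _.
have [B lt_B ok] := winner_demand (@votesP I) n0 win.
(* Truncation brings the shifts below [m], as the greedy bound requires. It leaves the coverage
   unchanged and, by [price_stable], the cost. *)
pose ts i := minn (nth 0 u i) (position i p).
have ts_ord (i : 'I_n) : ts i = minn (tnth u i) (position i p).
  by rewrite /ts (tnth_nth 0).
exists B, ts; split=> // [c lt_c | i lt_i |].
(* The requirement on [p] itself is met for free, as [p] covers itself in all votes. *)
- have [cp | ncp] := eqVneq (Ordinal lt_c) p.
    have -> : c = p by rewrite -cp.
    by rewrite coverage_target requirement_le // ltnW.
  apply: leq_trans (_ : demand p (votes I) B (Ordinal lt_c) <= _).
    by rewrite -requirementE.
  rewrite (@coverage_support ts (Ordinal lt_c) u) ?ok // => i.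
  rewrite ts_ord /covers; move: (position i p) (position _ _) (tnth u i) => a b k'; lia.
- by apply: leq_ltn_trans (geq_minr _ _) _; apply: position_lt.
rewrite -cost_u; apply: eq_bigr => i _; rewrite ts_ord shift_price_ord.
rewrite position_ord; case: leqP => // lt_u.
by rewrite [RHS]price_stable.
Qed.

End Encoding.

(** For [m >= 2] the summand 1 in [1 + ln m] is at most [ln m / ln 2], whence the constant. *)
Lemma harmonic_le (R : realType) m : (2 <= m)%N ->
  (harmonic R m <= ((ln 2)^-1 + 1) * ln m%:R)%R.
Proof.
move=> m2; apply: le_trans (harmonic_le_ln R (ltnW m2)) _.
have ln2 : (0 < ln 2 :> R)%R by rewrite ln_gt0 // ltr1n.
rewrite mulrDl mul1r lerD2r mulrC ler_pdivlMr // mul1r ler_ln ?posrE ?ltr0n ?ler_nat //.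
exact: ltnW.
Qed.

(** * Input, output and the final bounds *)

Definition read_next : prog :=
  Then (Read (Addr vX (Var vQ))) (Store (Addr vQ (Lit 0)) (Op Plus (Var vQ) (Lit 1))).

Definition read_votes : prog := loop vI vN (loop vJ vM (Then read_next read_next)).

Definition write_best : prog := loop vI vN (Write (Arr vBest (Var vI))).

Definition read_header : prog :=
  Then (Read (Addr vM (Lit 0))) (Then (Read (Addr vN (Lit 0))) (Read (Addr vP (Lit 0)))).

(* Without voters the machine has no time to count the candidates: their number
   is given in binary. *)
Definition solver : prog :=
  Then (Then read_header read_votes)
       (Then (If (Var vN) (compile cSolve) Skip) write_best).

(** The 100 is slack for the short expressions used in reading the input and in the test for
    voters. *)
Definition solver_weight : nat :=
  weight cSolve + loop_weight vI vN + loop_weight vJ vM +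
  (esize (Addr vX (Var vQ)) + esize (Arr vBest (Var vI)) + 100).

Definition solver_steps S : nat :=
  (1 + (1 + 1)) + (2 + S * (2 + (2 + S * (2 + (1 + 1 + (1 + 1)))))) +
  (1 + steps S cSolve + 1 + (2 + S * (2 + 1))).

Section Solver.
Variables (m n p : nat) (body : seq nat).

Let K := solver_weight.

Definition reading q i j st : Prop :=
  [/\ [/\ arr (Defs.mem st) vM 0 = m, arr (Defs.mem st) vN 0 = n & arr (Defs.mem st) vP 0 = p],
      [/\ arr (Defs.mem st) vQ 0 = q, arr (Defs.mem st) vI 0 = i & arr (Defs.mem st) vJ 0 = j],
      forall k, k < q -> arr (Defs.mem st) vX k = nth 0 body k,
      input st = drop q body & output st = [::]].

Lemma read_nextP q i j : q < size body ->
  hoare K (1 + 1) (reading q i j) read_next (reading q.+1 i j).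
Proof.
move=> lt_q.
have le_r : esize (Addr vX (Var vQ)) < K by rewrite /K /solver_weight; lia.
have le_s : esize (Addr vQ (Lit 0)) + esize (Op Plus (Var vQ) (Lit 1)) <= K.
  by rewrite /K /solver_weight [esize (Addr vQ _)]/= [esize (Op _ _ _)]/=; lia.
apply: (hoare_conseq (leqnn _) _ (fun st h => h)
  (hoare_Then (@hoare_Read K _ _ le_r)
     (@hoare_Store K _ _ (reading q.+1 i j) le_s isT))).
move=> st [[eM eN eP] [eQ eI eJ] eX ein eout].
rewrite ein (drop_nth 0 lt_q); split=> //.
rewrite !eval_Addr !eval_Op !eval_Var !eval_Lit /reading /= !arr_update /= eQ.
split=> //; first by rewrite addn1.
move=> k; rewrite ltnS leq_eqVlt arr_update arr_update /=.
by case: eqP => [-> //|_] /= /eX.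
Qed.

Lemma read_headerP :
  hoare K (1 + (1 + 1))
    (fun st => st = State (fun=> 0) [:: m, n, p & body] [::])
    read_header (reading 0 0 0).
Proof.
have le_K a : a <= vP -> esize (Addr a (Lit 0)) < K.
  by move=> le_a; rewrite /K /solver_weight [esize (Addr _ _)]/=; lia.
apply: (hoare_conseq (leqnn _) _ (fun st h => h)
  (hoare_Then (@hoare_Read K _ _ (le_K vM isT))
    (hoare_Then (@hoare_Read K _ _ (le_K vN isT))
       (@hoare_Read K _ (reading 0 0 0) (le_K vP isT))))).
move=> st ->; do 3 split=> //; rewrite !eval_Addr !eval_Lit.
all: by split; rewrite /= ?arr_update ?drop0.
Qed.

Variable S : nat.
Hypothesis le_nS : n <= S.

Lemma write_bestP (good : (nat -> nat) -> Prop) :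
  hoare K (2 + S * (2 + 1))
    (fun st => exists2 b, good b & [/\ arr (Defs.mem st) vN 0 = n,
       forall i, i < n -> arr (Defs.mem st) vBest i = b i & output st = [::]])
    write_best
    (fun st => exists2 b, good b & output st = [seq b i | i <- iota 0 n]).
Proof.
pose Inv q st := exists2 b, good b &
  [/\ arr (Defs.mem st) vI 0 = q, arr (Defs.mem st) vN 0 = n,
     forall i, i < n -> arr (Defs.mem st) vBest i = b i
   & output st = [seq b i | i <- iota 0 q]].
apply: (hoare_conseq (leqnn _) _ _ (@hoare_loop K S _ vI vN _ n Inv _ le_nS _ _)).
- move=> st [b okb [eN eb eo]]; exists b => //.
  by split; rewrite /= ?arr_update // => i /eb; rewrite arr_update.
- by move=> st [b okb [_ _ _ eo]]; exists b.
- by rewrite /K /solver_weight; lia.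
- by move=> q st [b _ [eI eN _ _]].
move=> q lt_q; apply: (hoare_conseq (leqnn _) _ (fun st h => h) (@hoare_Write K _ _ _)).
  move=> st [b okb [eI eN eb eo]]; exists b => //.
  have ev : eval (Defs.mem st) (Arr vBest (Var vI)) = b q.
    by rewrite eval_Arr eval_Var eI eb.
  have seqS : [seq b i | i <- iota 0 q.+1] = rcons [seq b i | i <- iota 0 q] (b q).
    by rewrite -addn1 iotaD map_cat cats1.
  split; rewrite ?ev ?seqS /= ?arr_update //=.
  - by rewrite eI.
  - by move=> i /eb; rewrite arr_update.
  by rewrite eo.
by rewrite /K /solver_weight; lia.
Qed.

Hypotheses (size_body : size body = n * (m + m)) (le_mS : 0 < n -> m <= S).

(** Each of the [m] iterations reads two numbers, which exhausts the [m + m] entries of a row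
    without a loop bound other than [m]. *)
Lemma read_rowP i j0 : i < n ->
  hoare K (2 + S * (2 + (1 + 1 + (1 + 1))))
    (reading (i * (m + m)) i j0) (loop vJ vM (Then read_next read_next))
    (fun st => exists j, reading (i.+1 * (m + m)) i j st).
Proof.
move=> lt_i; have le_m := le_mS (leq_ltn_trans (leq0n _) lt_i).
pose Inv j := reading (i * (m + m) + (j + j)) i j.
apply: (hoare_conseq (leqnn _) _ _ (@hoare_loop K S _ vJ vM _ m Inv _ le_m _ _)).
- move=> st [[eM eN eP] [eQ eI eJ] eX ein eout].
  by split; rewrite /= ?arr_update ?addn0 //= => k /eX; rewrite arr_update.
- by move=> st h; exists m; rewrite mulSn addnC.
- by rewrite /K /solver_weight; lia.
- by move=> j st [[eM _ _] [_ _ eJ] _ _ _].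
move=> j lt_j; pose q := i * (m + m) + (j + j).
have lt_q : q.+1 < size body by rewrite size_body /q; nia.
apply: (hoare_conseq (leqnn _) _ _
  (hoare_Then (@read_nextP q i j (ltnW lt_q)) (@read_nextP q.+1 i j lt_q))) => //.
move=> st [[eM eN eP] [eQ eI eJ] eX ein eout].
have e : i * (m + m) + (j.+1 + j.+1) = q.+2 by rewrite /q; lia.
by split; rewrite /= ?arr_update ?e ?eJ //= => k /eX; rewrite arr_update.
Qed.

Lemma read_votesP :
  hoare K (2 + S * (2 + (2 + S * (2 + (1 + 1 + (1 + 1))))))
    (reading 0 0 0) read_votes (fun st => exists j, reading (n * (m + m)) n j st).
Proof.
pose Inv i st := exists j, reading (i * (m + m)) i j st.
apply: (hoare_conseq (leqnn _) _ (fun st h => h)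
  (@hoare_loop K S _ vI vN _ n Inv _ le_nS _ _)).
- move=> st [[eM eN eP] [eQ eI eJ] eX ein eout]; exists 0.
  by split; rewrite /= ?arr_update ?mul0n //= => k /eX; rewrite arr_update.
- by rewrite /K /solver_weight; lia.
- by move=> i st [j [[_ eN _] [_ eI _] _ _ _]].
move=> i lt_i L st [j rd] bd.
have [st' [T [ex [j' rd'] bd' leT]]] := @read_rowP i j lt_i L st rd bd.
exists st', T; split=> //; exists j'; case: rd' => [[eM eN eP] [eQ eI eJ] eX ein eout].
by split; rewrite /= ?arr_update ?eI //= => k /eX; rewrite arr_update.
Qed.

Lemma solveP (good : (nat -> nat) -> Prop) :
  (forall mu, arr mu vM 0 = m -> arr mu vN 0 = n -> arr mu vP 0 = p ->
     (forall k, k < size body -> arr mu vX k = nth 0 body k) -> 0 < n ->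
     exists2 b, good b & forall i, i < n -> arr (sem cSolve mu) vBest i = b i) ->
  (n = 0 -> good (fun=> 0)) ->
  hoare K (1 + steps S cSolve + 1)
    (fun st => exists j, reading (n * (m + m)) n j st)
    (If (Var vN) (compile cSolve) Skip)
    (fun st => exists2 b, good b & [/\ arr (Defs.mem st) vN 0 = n,
       forall i, i < n -> arr (Defs.mem st) vBest i = b i & output st = [::]]).
Proof.
move=> solve no_voter.
apply: hoare_If.
- by rewrite /K /solver_weight [esize (Var _)]/=; lia.
- move=> L [mu xs ys] [[j [[eM eN eP] _ eX _ eout]]].
  rewrite eval_Var eN -lt0n => n0; move: eM eN eP eX eout => /= eM eN eP eX -> bd.
  have [||||] := @hoare_compile K S cSolve mu xs [::] wf_cSolve _ _ _ _ L _ erefl bd.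
  + by rewrite /K /solver_weight -!addnA leq_addr.
  + by rewrite /K /solver_weight; lia.
  + by rewrite eM le_mS.
  + by rewrite eN.
  move=> st' [T [ex st'E bd' leT]]; rewrite {}st'E in ex bd'.
  exists (State (sem cSolve mu) xs [::]), T; split=> //.
  have [|b okb eb] := solve mu eM eN eP _ n0; first by rewrite size_body.
  by exists b => //; split=> //=; rewrite sem_frame.
apply: (hoare_conseq (leqnn _) _ (fun st h => h) (@hoare_Skip K _ _)); last first.
  by rewrite /K /solver_weight; lia.
move=> st [[j [[eM eN eP] _ eX _ eout]]]; rewrite eval_Var eN => n0.
by exists (fun=> 0); [apply: no_voter | split=> // i; rewrite n0].
Qed.

End Solver.

Local Open Scope ring_scope.

Theorem theorem4p5 (R : realType) :
  exists (A : prog) (c k : nat) (kappa : R),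
  forall I : instance,
  exists (s : (nvoter I).-tuple nat) (T : nat),
    [/\ outputs_in A (encode I) s T,
        (T <= c * rep_size I ^ k + c)%N,
        successful s
      & (2 <= ncand I)%N ->
        (shift_cost s)%:R <= kappa * ln ((ncand I)%:R : R) * (opt I)%:R].
Proof.
have [ct [k poly]] : exists c k, forall S, (0 < S ->
    time_bound solver_weight (solver_steps S) S <= c * S ^ k)%N.
  have [c0 [d0 h0]] : exists c d, forall S, (0 < S -> solver_steps S <= c * S ^ d)%N.
    have [c [d le_c]] := steps_poly cSolve.
    (* Apart from [steps S cSolve], the step count is [9 + 7 S + 6 S^2], which is at most
       [22 S^2]. *)
    exists (22 + c)%N, d.+2 => S S0.
    have S1 : (1 <= S ^ d)%N by rewrite expn_gt0 S0.
    have le_st := le_c S S0; rewrite /solver_steps !expnS (mulnA S S).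
    have S2 : (S * S <= S * S * S ^ d)%N by rewrite leq_pmulr.
    have S3 : (c * S ^ d <= c * (S * S * S ^ d))%N.
      by rewrite leq_mul2l leq_pmull ?muln_gt0 ?S0 ?orbT.
    have S4 : (S <= S * S)%N by rewrite leq_pmulr.
    move: S2 S3; set P := (S * S * S ^ d)%N => S2 S3.
    by rewrite mulnDl; lia.
  exists (c0 * solver_weight ^ 2 * (1 + c0 * solver_weight))%N, (d0 + d0.+1)%N => S S0.
  rewrite /time_bound; set K := solver_weight; have := h0 S S0; set s := solver_steps S => le_s.
  have S1 : (1 <= S ^ d0)%N by rewrite expn_gt0 S0.
  have le_sum : (S + s * K <= (1 + c0 * K) * S ^ d0.+1)%N.
    rewrite expnS mulnDl mul1n leq_add ?leq_pmulr //.
    rewrite -mulnA [(K * _)%N]mulnC mulnA leq_mul2r; apply/orP; right.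
    by apply: leq_trans le_s _; rewrite leq_mul2l leq_pmull ?orbT.
  apply: leq_trans (leq_mul (leq_mul le_s (leqnn _)) le_sum) _.
  by rewrite expnD; apply/eq_leq; ring.
exists solver, ct, k, ((ln 2)^-1 + 1) => I.
set m := ncand I; set n := nvoter I; set p := target I.
pose good (b : nat -> nat) := successful (shift_action I b) /\
  ((2 <= m)%N -> (shift_cost (shift_action I b))%:R
                 <= ((ln 2)^-1 + 1) * ln (m%:R : R) * (opt I)%:R).
have S0 : (0 < rep_size I)%N by rewrite /rep_size encodeE big_cons addn_gt0.
have le_S := @size_le_rep I.
have le_mS : (0 < n -> m <= rep_size I)%N by move/le_S => /andP[].
have le_nS : (n <= rep_size I)%N.
  by case: (posnP n) => [-> // | /le_S /andP[]].
have size_body : size (flatten (rows I)) = (n * (m + m))%N by apply: size_flatten_rows.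
have no_voter : n = 0%N -> good (fun=> 0%N).
  move=> n0; split.
    apply: (@meets_successful I 0) => // c _.
    apply: leq_trans (requirement_le _ _ _ _ (leq0n _)) _.
    by rewrite [nvoter I]n0.
  rewrite cost_shift_action /cost -/n n0 big_ord0 => m2.
  rewrite !mulr_ge0 ?ler0n ?addr_ge0 ?invr_ge0 ?ln_ge0 ?ler1n //; exact: ltnW.
have solve mu : arr mu vM 0 = m -> arr mu vN 0 = n -> arr mu vP 0 = p ->
    (forall k, (k < size (flatten (rows I)))%N -> arr mu vX k = nth 0%N (flatten (rows I)) k) ->
    (0 < n)%N ->
    exists2 b, good b & forall i, (i < n)%N -> arr (sem cSolve mu) vBest i = b i.
  move=> eM eN eP eX n0.
  have E : env n m p (position I) (shift_price I) (sem cPos mu).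
    apply: (@cPosP n m p _ _ (fun i j => nth 0%N (ranking I i) j)) => //.
    - move=> i j lt_i lt_j; rewrite eX ?nth_encoding_rank //.
      by rewrite size_body; nia.
    - move=> i j lt_i lt_j; rewrite eX ?nth_encoding_price //.
      by rewrite size_body; nia.
    - move=> i j lt_i lt_j; rewrite -(mem_ranking _ lt_i) mem_nth ?size_ranking //.
      by rewrite /position index_uniq ?uniq_ranking ?size_ranking.
    move=> i c lt_i lt_c; rewrite position_lt //.
    by rewrite /position nth_index ?mem_ranking.
  have pos_p i : (i < n)%N -> (position I i p < m)%N by move=> lt_i; apply: position_lt.
  have [b [eb [B le_B okb] optb]] := cSolveP (ltn_ord p) R pos_p (shift_price0 I) E.
  exists b => //; split; first exact: meets_successful okb.
  move=> m2; have [B' [ts [lt_B' ok ts_lt <-]]] := @opt_meets I n0.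
  rewrite cost_shift_action; apply: le_trans (optb B' lt_B' ts ok ts_lt) _.
  by rewrite ler_wpM2r ?ler0n ?harmonic_le.
pose st0 := State (fun=> 0%N) (encode I) [::].
(* The representation size plays two roles: it bounds the length of the input numbers and, as [S],
   the loops. *)
have bd : bounded (rep_size I) st0.
  by split=> // [a|x]; [rewrite expn_gt0 | apply: encode_lt].
have run := hoare_Then
  (hoare_Then (@read_headerP m n p (flatten (rows I)))
     (read_votesP (p := p) le_nS size_body le_mS))
  (hoare_Then (solveP le_nS size_body le_mS solve no_voter) (write_bestP le_nS (good := good))).
have [st [T [ex [b [okb cost_b] out] _ le_T]]] := run _ st0 erefl bd.
exists (shift_action I b), T; split=> //.
- exists (Defs.mem st), (input st); suff <- : output st = tval (shift_action I b) by case: st ex out.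
  by rewrite out /= -val_enum_ord -map_comp.
- by apply: leq_trans le_T _; apply: leq_trans (poly _ S0) _; rewrite leq_addr.
Qed.
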